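(* Let $B\subset A$ be an inclusion of simple unital $C^*$-algebras with a conditional expectation of index-finite type. For every $n\ge1$, the rotation operator $\rho_n^-:A'\cap A_{n+1}\to A'\cap A_{n+1}$ satisfies $(\rho_n^-)^{n+1}=\mathrm{id}_{A'\cap A_{n+1}}$.
   Context: Setting. $B\subset A$ is an inclusion of simple unital $C^*$-algebras (common unit) admitting a conditional expectation of index-finite type. A conditional expectation $E:A\to B$ is of index-finite type if it has a quasi-basis, i.e. a finite set $\{\lambda_1,\dots,\lambda_m\}\subset A$ with $x=\sum_i\lambda_iE(\lambda_i^*x)=\sum_iE(x\lambda_i)\lambda_i^*$ for all $x\in A$; its Watatani index is $\sum_i\lambda_i\lambda_i^*$ (a positive scalar here). $E_0:A\to B$ is the minimal conditional expectation (the unique one of smallest index), $[A:B]_0$ is its index, $\tau=[A:B]_0^{-1}$. Put $A_{-1}=B$, $A_0=A$; for $n\ge1$, $A_n$ is the $C^*$-basic construction of $A_{n-2}\subset A_{n-1}$ with respect to $E_{n-1}$, with Jones projection $e_n\in A_n$ (so $e_nxe_n=E_{n-1}(x)e_n$ for $x\in A_{n-1}$ and $A_n=\mathrm{span}\,A_{n-1}e_nA_{n-1}$), and $E_n:A_n\to A_{n-1}$ is the dual (minimal) conditional expectation, $E_n(xe_ny)=\tau xy$ for $x,y\in A_{n-1}$. For $C\subset D$, $C'\cap D=\{d\in D: dc=cd\ \forall c\in C\}$; the relative commutants $B'\cap A_n$ are finite-dimensional. $\mathrm{tr}$ is the faithful tracial state on $B'\cap A_n$ given by the restriction of $E_0\circ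 E_1\circ\cdots\circ E_n$. Fourier transform. $v_n=e_ne_{n-1}\cdots e_1$. $E^{B'\cap A_n}_{A'\cap A_n}$ is the $\mathrm{tr}$-preserving conditional expectation; $E^{B'\cap A_n}_{A'\cap A_n}(x)=\tau\sum_i\lambda_ix\lambda_i^*$ for any quasi-basis $\{\lambda_i\}$ of $E_0$. $\mathcal F_n:B'\cap A_n\to A'\cap A_{n+1}$, $\mathcal F_n(x)=\tau^{-\frac{n+2}{2}}E^{B'\cap A_{n+1}}_{A'\cap A_{n+1}}(xv_{n+1})$, a bijection with inverse $\mathcal F_n^{-1}(w)=\tau^{-\frac{n+2}{2}}E_{n+1}(wv_{n+1}^* )$. Rotation. $\rho_n^-(w)=\big(\mathcal F_n(\mathcal F_n^{-1}(w)^* )\big)^*$ for $w\in A'\cap A_{n+1}$. *)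

(* Defs.v *)
From HB Require Import structures.
From mathcomp Require Import all_boot all_order all_algebra.
From mathcomp Require Import complex.
From mathcomp Require Import all_classical all_reals all_analysis.

Set Implicit Arguments.
Unset Strict Implicit.
Unset Printing Implicit Defensive.

Import Order.TTheory GRing.Theory Num.Theory.
Import numFieldNormedType.Exports.

Local Open Scope classical_set_scope.
Local Open Scope complex_scope.
Local Open Scope ring_scope.

(* The norm is a field of the structure, with real values: Hierarchy Builder
   cannot join GRing.Algebra with NormedModule, as no common ancestor of the two
   was declared before Num.NumDomain. *)
HB.mixin Record isCStarAlgebra (R : realType) A of GRing.Algebra R[i] A := {
  star : A -> A;
  cnorm : A -> R;
  star_semilinear : forall (c : R[i]) (x y : A),
    star (c *: x + y) = c^* *: star x + star y;
  starM : forall x y : A, star (x * y) = star y * star x;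
  starK : involutive star;
  cnorm_eq0 : forall x : A, cnorm x = 0 -> x = 0;
  cnormD : forall x y : A, cnorm (x + y) <= cnorm x + cnorm y;
  cnormZ : forall (c : R[i]) (x : A), cnorm (c *: x) = complex.Re `|c| * cnorm x;
  cnormM : forall x y : A, cnorm (x * y) <= cnorm x * cnorm y;
  cnorm_star : forall x : A, cnorm (star x * x) = cnorm x ^+ 2;
  cnorm_complete : forall u : nat -> A,
    (forall e : R, 0 < e -> exists N : nat, forall m n : nat,
       (N <= m)%N -> (N <= n)%N -> cnorm (u m - u n) < e) ->
    exists l : A, (fun n => cnorm (u n - l)) @ \oo --> (0 : R)
}.

#[short(type="cstarType")]
HB.structure Definition CStarAlgebra (R : realType) :=
  { A of GRing.Algebra R[i] A & isCStarAlgebra R A }.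

Section Inclusions.
Context {R : realType}.
Implicit Types B A M : cstarType R.

Definition cnorm_closed A (I : set A) : Prop :=
  forall x, (forall e : R, 0 < e -> exists2 y, I y & cnorm (x - y) < e) -> I x.

Definition simple_cstar A : Prop :=
  forall I : set A, cnorm_closed I -> I 0 ->
    (forall x y, I x -> I y -> I (x + y)) ->
    (forall a x, I x -> I (a * x)) -> (forall a x, I x -> I (x * a)) ->
  I = [set 0] \/ I = setT.

(* An injective *-homomorphism between C*-algebras is isometric, so this is
   the identification of B with a C*-subalgebra of A having the same unit. *)
Definition cstar_inclusion B A (i : B -> A) : Prop :=
  [/\ linear i, monoid_morphism i, forall b, i (star b) = star (i b)
    & injective i].

Definition commutant A (S : set A) : set A :=
  [set x | forall s, S s -> x * s = s * x].

(* G, of which only the values on P matter, is a conditional expectation of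
   the C*-algebra P onto its C*-subalgebra Q. *)
Definition cond_exp_on A (P Q : set A) (G : A -> A) : Prop :=
  [/\ forall x, P x -> Q (G x),
      forall (c : R[i]) x y, P x -> P y -> G (c *: x + y) = c *: G x + G y,
      forall x, P x -> exists2 q, Q q & G (star x * x) = star q * q,
      forall q, Q q -> G q = q
    & forall q x, Q q -> P x -> G (q * x) = q * G x /\ G (x * q) = G x * q].

Definition cond_exp B A (i : B -> A) (E : A -> B) : Prop :=
  cond_exp_on setT (range i) (i \o E).

Definition quasi_basis B A (i : B -> A) (E : A -> B) (s : seq A) : Prop :=
  forall x : A, x = \sum_(l <- s) l * i (E (star l * x)) /\
                x = \sum_(l <- s) i (E (x * l)) * star l.

Definition index_finite B A (i : B -> A) (E : A -> B) : Prop :=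
  exists s, quasi_basis i E s.

(* The Watatani index, a central element of A, is the scalar r; when A is
   simple the index is always a scalar. *)
Definition has_index B A (i : B -> A) (E : A -> B) (r : R) : Prop :=
  exists2 s, quasi_basis i E s & \sum_(l <- s) l * star l = r%:C *: 1.

Definition minimal_cond_exp B A (i : B -> A) (E : A -> B) : Prop :=
  [/\ cond_exp i E, index_finite i E
    & forall (F : A -> B) (r s : R), cond_exp i F ->
        has_index i E r -> has_index i F s -> r <= s].

(* S is the adjoint of T on the Hilbert B-module A, whose inner product is
   <x, y> = E (x^* y). *)
Definition adjoint_for B A (E : A -> B) (T S : A -> A) : Prop :=
  forall x y, E (star (T x) * y) = E (star x * S y).

(* M, containing A by j, is the C*-basic construction of B in A with respect
   to E, with Jones projection e: act identifies M with the *-algebra of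
   adjointable B-module maps of A spanned by the products x e y, where x and y
   are left multiplications by elements of A and e is the operator E.  As E
   has a quasi-basis, A is already complete for the norm |E (x^* x)|^(1/2) and
   this span is already closed, so no completion is taken. *)
Definition basic_construction B A M (i : B -> A) (E : A -> B)
    (j : A -> M) (e : M) : Prop :=
  exists act : M -> A -> A,
  [/\ [/\ forall m, linear (act m),
          forall m x b, act m (x * i b) = act m x * i b
        & forall m, adjoint_for E (act m) (act (star m))],
      [/\ forall (c : R[i]) m m' x,
            act (c *: m + m') x = c *: act m x + act m' x,
          forall m m' x, act (m * m') x = act m (act m' x)
        & injective act],
      forall a x, act (j a) x = a * x,
      forall x, act e x = i (E x)
    & forall m, exists s : seq (A * A),
        m = \sum_(p <- s) j p.1 * e * j p.2].

(* E1 is the expectation dual to E, tau being the inverse index of E. *)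
Definition dual_cond_exp A M (j : A -> M) (e : M) (tau : R)
    (E1 : M -> A) : Prop :=
  cond_exp j E1 /\ forall x y, E1 (j x * e * j y) = tau%:C *: (x * y).

End Inclusions.

(* Indices are shifted by one with respect to A_(-1) = B, A_0 = A:
     alg n   is A_(n-1),           inc n  is the inclusion of A_(n-1) in A_n,
     E n     is E_n : A_n -> A_(n-1),
     jones n is e_(n+1), an element of A_(n+1). *)
Record tower (R : realType) := Tower {
  alg : nat -> cstarType R;
  inc : forall n, alg n -> alg n.+1;
  E : forall n, alg n.+1 -> alg n;
  jones : forall n, alg n.+2 }.
Arguments inc {R} t n _.
Arguments E {R} t n _.
Arguments jones {R} t n.

Section Tower.
Context {R : realType} (T : tower R).

Definition is_jones_tower (tau : R) : Prop :=
  [/\ forall n, cstar_inclusion (inc T n),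
      minimal_cond_exp (inc T 0) (E T 0),
      has_index (inc T 0) (E T 0) tau^-1,
      forall n, basic_construction (inc T n) (E T n) (inc T n.+1) (jones T n)
    & forall n, dual_cond_exp (inc T n.+1) (jones T n) tau (E T n.+1)].

Fixpoint incA n : alg T 1 -> alg T n.+1 :=
  if n is n'.+1 then fun a => inc T n'.+1 (incA n' a) else id.

Definition incB n (b : alg T 0) : alg T n.+1 := incA n (inc T 0 b).

(* relA n is A' n A_n and relB n is B' n A_n *)
Definition relA n : set (alg T n.+1) := commutant (range (incA n)).
Definition relB n : set (alg T n.+1) := commutant (range (@incB n)).
Arguments relA : clear implicits.
Arguments relB : clear implicits.

(* E_0 o E_1 o ... o E_n, with values in B.  Its restriction to relB n is
   tr (x) 1, as it takes values in the centre of B, which is C 1. *)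
Fixpoint Etr n : alg T n.+1 -> alg T 0 :=
  if n is n'.+1 then fun x => Etr (E T n'.+1 x) else E T 0.

Definition tr_preserving_cond_exp n (G : alg T n.+1 -> alg T n.+1) : Prop :=
  cond_exp_on (relB n) (relA n) G /\ forall x, relB n x -> Etr (G x) = Etr x.

(* v_n = e_n e_(n-1) ... e_1 *)
Fixpoint v n : alg T n.+1 :=
  if n is n'.+1 then jones T n' * inc T n'.+1 (v n') else 1.

(* G n stands for the tr-preserving expectation of B' n A_n on A' n A_n. *)
Variables (tau : R) (G : forall n, alg T n.+1 -> alg T n.+1).

Definition fourier n (x : alg T n.+1) : alg T n.+2 :=
  (tau `^ (- (n.+2%:R / 2)))%:C *: G (inc T n.+1 x * v n.+1).

(* The set-theoretic inverse of the restriction of fourier n to B' n A_n. *)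
Definition fourier_inv n : alg T n.+2 -> alg T n.+1 :=
  'pinv_(fun=> 0) (relB n) (@fourier n).

Definition rotation n (w : alg T n.+2) : alg T n.+2 :=
  star (fourier (star (fourier_inv w))).

End Tower.

Arguments relA {R} T n _.
Arguments relB {R} T n _.
Arguments fourier {R T} tau G {n} x.
Arguments fourier_inv {R T} tau G {n} _.
Arguments rotation {R T} tau G {n} w.

(* Main.v *)
Require Import Defs.
From HB Require Import structures.
From mathcomp Require Import all_boot all_order all_algebra.
From mathcomp Require Import ring lra.
From mathcomp Require Import complex.
From mathcomp Require Import all_classical all_reals all_analysis.

(* Identify A_n with the (n+1)-fold tensor product of A over B, the element
   y_1 v_1 y_2 v_2 ... v_n y_(n+1) being y_1 (x) ... (x) y_(n+1).  Conjugated by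
   the Fourier transform, the rotation maps x = y_1 (x) ... (x) y_(n+1) to
   sum_l l (x) y_1 (x) ... (x) y_n E_0(y_(n+1) l^* ), l running over a
   quasi-basis of E_0.  Write phi for E_0 E_1 ... E_n.  The (n+1)-st iterate maps
   x to the sum of the W phi(x W^* ), where W runs over the quasi-basis of phi
   made of the words in the l, while x itself is the sum of the W phi(W^* x).
   So everything rests on phi(x a) = phi(a x) for x in B' n A_n and a in A_n.

   There is an automorphism theta of B' n A_n with phi(a x) = phi(theta(x) a).
   As the index of E_0(g . g) / E_0(g^2), for g = 1 + t x, is stationary at
   t = 0, the sum of the W x W^* is a multiple of phi(x); this forces
   theta^2 = 1, and theta = 1 since theta is positive for the inner product of
   phi.  That phi is scalar on B' n A_n, and that scalars of the form q^* q are
   nonnegative, is shown without spectral theory from the inequality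
   |a|^2 <= |a^2 + b^2| for commuting self-adjoint a and b. *)

Set Implicit Arguments.
Unset Strict Implicit.
Unset Printing Implicit Defensive.

Import Order.TTheory GRing.Theory Num.Theory.
Import numFieldNormedType.Exports.

Local Open Scope classical_set_scope.
Local Open Scope complex_scope.
Local Open Scope ring_scope.

HB.instance Definition _ (R : realType) (A : cstarType R) :=
  GRing.isLinear.Build R[i] A A (Num.conj \; *:%R) (@star R A)
    (@star_semilinear R A).

(** * C*-algebras *)

Section CStarAlgebras.
Context {R : realType}.
Implicit Type A : cstarType R.

Lemma starD A (x y : A) : star (x + y) = star x + star y.
Proof. exact: raddfD. Qed.

Lemma starB A (x y : A) : star (x - y) = star x - star y.
Proof. exact: raddfB. Qed.

Lemma starN A (x : A) : star (- x) = - star x.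
Proof. exact: raddfN. Qed.

Lemma starZ A (c : R[i]) (x : A) : star (c *: x) = c^* *: star x.
Proof. exact: linearZ. Qed.

Lemma star0 A : star 0 = 0 :> A.
Proof. exact: raddf0. Qed.

Lemma star1 A : star 1 = 1 :> A.
Proof. by have := starM (1 : A) (star 1); rewrite mul1r !starK mul1r. Qed.

Lemma conjC_real (r : R) : (r%:C)^* = r%:C.
Proof. by apply/CrealP; rewrite complex_real. Qed.

Lemma conjc_i : ('i%C : R[i])^* = - 'i%C.
Proof. by rewrite complexiE conjCi. Qed.

Lemma starZr A (r : R) (x : A) : star (r%:C *: x) = r%:C *: star x.
Proof. by rewrite starZ conjC_real. Qed.

Lemma cnormZr A (r : R) (x : A) : cnorm (r%:C *: x) = `|r| * cnorm x.
Proof. by rewrite cnormZ normc_def /= expr0n addr0 sqrtr_sqr. Qed.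

Lemma cnorm_double A (x : A) : cnorm (x *+ 2) = 2 * cnorm x.
Proof.
by rewrite -scaler_nat -(rmorph_nat (real_complex R)) cnormZr ger0_norm ?ler0n.
Qed.

Lemma cnorm0 A : cnorm (0 : A) = 0.
Proof. by rewrite -(scale0r (0 : A)) cnormZ normr0 mul0r. Qed.

Lemma cnormN A (x : A) : cnorm (- x) = cnorm x.
Proof. by rewrite -scaleN1r cnormZ normrN1 mul1r. Qed.

Lemma cnormB A (x y : A) : cnorm (x - y) <= cnorm x + cnorm y.
Proof. by rewrite -(cnormN y) cnormD. Qed.

Lemma cnorm_ge0 A (x : A) : 0 <= cnorm x.
Proof. by have := cnormB x x; rewrite subrr cnorm0; lra. Qed.

Lemma cnorm_sum A I (s : seq I) (F : I -> A) :
  cnorm (\sum_(i <- s) F i) <= \sum_(i <- s) cnorm (F i).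
Proof.
elim: s => [|i s IHs]; first by rewrite !big_nil cnorm0.
by rewrite !big_cons (le_trans (cnormD _ _)) // lerD2l.
Qed.

Lemma cnorm_le_eq0 A (x : A) : (forall e : R, 0 < e -> cnorm x <= e) -> x = 0.
Proof.
move=> h; apply: cnorm_eq0; apply/eqP; rewrite eq_le cnorm_ge0 andbT.
by rewrite leNgt; apply/negP => x0; have := h (cnorm x / 2); lra.
Qed.

Lemma star_mul_eq0 A (x : A) : star x * x = 0 -> x = 0.
Proof.
move=> xx0; apply: cnorm_eq0; apply/eqP.
by rewrite -sqrf_eq0 -cnorm_star xx0 cnorm0.
Qed.

Lemma cnorm_starE A (x : A) : cnorm (star x) = cnorm x.
Proof.
have le_star (y : A) : cnorm y <= cnorm (star y).
  have [->|y0] := eqVneq (cnorm y) 0; first exact: cnorm_ge0.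
  have yp : 0 < cnorm y by rewrite lt_neqAle eq_sym y0 cnorm_ge0.
  by rewrite -(ler_pM2r yp) -expr2 -cnorm_star cnormM.
by apply/eqP; rewrite eq_le le_star -{2}(starK x) le_star.
Qed.

Lemma cnorm1 A : cnorm (1 : A) = 1.
Proof.
have n1 : cnorm (1 : A) != 0 by apply/eqP => /cnorm_eq0/eqP; rewrite oner_eq0.
by apply: (mulfI n1); rewrite mulr1 -expr2 -cnorm_star star1 mulr1.
Qed.

Lemma cnorm_sqr A (x : A) : star x = x -> cnorm (x ^+ 2) = cnorm x ^+ 2.
Proof. by move=> sx; rewrite -cnorm_star sx. Qed.

Lemma cnormX_le A (x : A) n : cnorm (x ^+ n) <= cnorm x ^+ n.
Proof.
elim: n => [|n IHn]; first by rewrite !expr0 cnorm1.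
by rewrite !exprS (le_trans (cnormM _ _)) // ler_wpM2l // cnorm_ge0.
Qed.

Lemma starX A (x : A) n : star x = x -> star (x ^+ n) = x ^+ n.
Proof.
move=> sx; elim: n => [|n IHn]; first by rewrite expr0 star1.
by rewrite exprS starM IHn sx -exprSr -exprS.
Qed.


Lemma half_double A (x : A) : (2^-1)%:C *: (x + x) = x.
Proof. by rewrite scalerDr -scalerDl -raddfD /= -div1r -splitr scale1r. Qed.

Definition cre A (x : A) : A := (2^-1)%:C *: (x + star x).
Definition cim A (x : A) : A := (2^-1)%:C *: ('i%C *: (star x - x)).

Lemma star_cre A (x : A) : star (cre x) = cre x.
Proof. by rewrite starZr starD starK addrC. Qed.

Lemma star_cim A (x : A) : star (cim x) = cim x.
Proof. by rewrite starZr starZ conjc_i starB starK scaleNr -scalerN opprB. Qed.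

Lemma cre_cimE A (x : A) : x = cre x + 'i%C *: cim x.
Proof.
have ii : 'i%C * 'i%C = -1 :> R[i] by rewrite -expr2 sqr_i.
rewrite /cre /cim !scalerA mulrAC ii mulN1r scaleNr -scalerN opprB.
by rewrite -scalerDr -addrA [star x + _]addrC subrK half_double.
Qed.

Lemma cnorm_real_le A (a b : A) : star a = a -> star b = b -> a * b = b * a ->
  cnorm a ^+ 2 <= cnorm (a ^+ 2 + b ^+ 2).
Proof.
move=> sa sb ab; pose u := a + 'i%C *: b.
have ii : 'i%C * 'i%C = -1 :> R[i] by rewrite -expr2 sqr_i.
have su : star u = a - 'i%C *: b by rewrite starD starZ conjc_i sa sb scaleNr.
have uu : star u * u = a ^+ 2 + b ^+ 2.
  rewrite su /u mulrDr !mulrBl -!scalerAl -!scalerAr scalerA ii scaleN1r opprK.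
  by rewrite ab !expr2 addrA subrK.
rewrite -uu cnorm_star lerXn2r ?nnegrE ?cnorm_ge0 //.
have : cnorm (a + a) <= cnorm u + cnorm u.
  have -> : a + a = star u + u by rewrite su /u addrACA addNr addr0.
  by rewrite (le_trans (cnormD _ _)) // cnorm_starE.
by rewrite -mulr2n cnorm_double; clear; lra.
Qed.

Lemma sqrrD_sqrrB (S : nzRingType) (x y : S) : GRing.comm x y ->
  (x + y) ^+ 2 = (x * y) *+ 4 + (x - y) ^+ 2.
Proof.
move=> xy; rewrite !expr2 mulrDl mulrBl !mulrBr !mulrDr -xy opprB [RHS]addrC.
have -> : x * x - x * y + (y * y - x * y) = x * x + y * y - x * y *+ 2.
  by rewrite addrACA -opprD mulr2n.
rewrite [x * y + _]addrC addrACA -mulr2n.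
by rewrite (mulrnDr _ 2 2) [RHS]addrA subrK.
Qed.

(* The quotient [(1 - z ^+ (2 ^ k.+1)) / (1 - z ^+ 2)]. *)
Fixpoint dyadic_geom A (z : A) k : A :=
  if k is k'.+1 then dyadic_geom z k' * (1 + z ^+ (2 ^ k)) else 1.

Lemma dyadic_geomE A (z : A) k :
  dyadic_geom z k * (1 - z ^+ 2) = 1 - z ^+ (2 ^ k.+1).
Proof.
elim: k => [|k IHk]; first by rewrite mul1r.
have -> : dyadic_geom z k.+1 * (1 - z ^+ 2) =
    dyadic_geom z k * (1 - z ^+ 2) * (1 + z ^+ (2 ^ k.+1)).
  rewrite /= -!mulrA; congr (_ * _).
  apply/commr_sym/commrD; first exact: commr1.
  apply/commr_sym/commrB; first exact: commr1.
  by rewrite /GRing.comm -!exprD addnC.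
by rewrite IHk mulrDr mulr1 mulrBl mul1r -exprD addnn -mul2n -expnS addrA subrK.
Qed.

Lemma dyadic_geom_ge A (z : A) k j : star z = z -> cnorm z = 1 ->
  2 ^+ k <= cnorm (z ^+ j * dyadic_geom z k).
Proof.
move=> sz nz; elim: k j => [|k IHk] j.
  rewrite mulr1 expr0.
  have [m jm] : exists m, (j <= 2 ^ m)%N by exists j; rewrite ltnW // ltn_expl.
  have n2 : cnorm (z ^+ (2 ^ m)) = 1.
    elim: m {jm} => [|m IHm]; first by rewrite expr1.
    by rewrite expnS mulnC exprM cnorm_sqr ?starX // IHm expr1n.
  rewrite -n2 -(subnK jm) exprD (le_trans (cnormM _ _)) // ler_piMl ?cnorm_ge0 //.
  by rewrite (le_trans (cnormX_le _ _)) // nz expr1n.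
have comg i l : GRing.comm (z ^+ i) (dyadic_geom z l).
  elim: l => [|l IHl]; first exact: commr1.
  apply: commrM => //; apply: commrD; first exact: commr1.
  exact/commrX/commr_sym/commrX.
have sg l : star (dyadic_geom z l) = dyadic_geom z l.
  elim: l => [|l IHl]; first by rewrite star1.
  rewrite /= starM IHl starD star1 starX // -/dyadic_geom.
  by apply: commr_sym; apply: commrD; [apply: commr1 | apply/commr_sym/comg].
pose w := z ^+ (2 ^ k); pose p := z ^+ j * dyadic_geom z k.
have pw : GRing.comm p w.
  apply/commr_sym/commrM; first exact/commr_sym/commrX/commr_sym/commrX.
  exact: comg.
have sp : star p = p by rewrite starM sg starX // -comg.
have sw : star w = w by rewrite starX.
have pww : GRing.comm p (w ^+ 2) by apply: commrX.
set s := _ * _; have sE : s = p + p * w ^+ 2.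
  by rewrite /s /= mulrA expnS mulnC exprM mulrDr mulr1.
have ss : star s = s by rewrite sE starD sp starM sp starX // pww.
have := @cnorm_real_le _ (p * w *+ 2) (p - p * w ^+ 2).
have -> : (p * w *+ 2) ^+ 2 + (p - p * w ^+ 2) ^+ 2 = s ^+ 2.
  have cpp : GRing.comm p (p * w ^+ 2) by apply: commrM.
  rewrite sE (sqrrD_sqrrB cpp); congr (_ + _).
  by rewrite exprMn_n (exprMn_comm _ pw) [p ^+ 2]expr2 -mulrA.
have spw : star (p * w) = p * w by rewrite starM sp sw pw.
rewrite cnorm_sqr // raddfMn /= spw raddfB /= sp starM sp starX // -pww.
have cpw : GRing.comm (p * w *+ 2) (p - p * w ^+ 2).
  apply/commr_sym/commrMn/commr_sym/commrB; apply/commr_sym.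
    by apply: commrM.
  by apply: commrM; apply/commr_sym; apply: commrM => //; apply: commrX.
move=> /(_ erefl erefl cpw).
have := IHk (j + 2 ^ k)%N; have -> : z ^+ (j + 2 ^ k) * dyadic_geom z k = p * w.
  by rewrite exprD -!mulrA comg.
rewrite cnorm_double [2 ^+ k.+1]exprS => h1 h2.
apply: (le_trans (ler_wpM2l (ler0n R 2) h1)).
by rewrite -ler_sqr ?nnegrE ?mulr_ge0 ?cnorm_ge0.
Qed.

(* Since [1 - z ^+ 2] divides [1 - z ^+ (2 ^ k)] with a quotient of norm at
   least [2 ^ k.-1], it is not even approximately invertible. *)
Lemma approx_inv_sqr_ge A (z y : A) : star z = z -> cnorm z = 1 ->
  2^-1 <= cnorm (1 - (1 - z ^+ 2) * y).
Proof.
move=> sz nz; rewrite leNgt; apply/negP => hlt.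
have [k hk] : exists k : nat, 4 * cnorm y < 2 ^+ k.
  have := archi_boundP (mulr_ge0 (ler0n R 4) (cnorm_ge0 y)).
  set k := Num.bound _ => hk; exists k; apply: lt_le_trans hk _.
  by rewrite -natrX ler_nat ltnW // ltn_expl.
set h := 1 - _ in hlt; set q := dyadic_geom z k.
have qE : q = q * h + (1 - z ^+ (2 ^ k.+1)) * y.
  by rewrite -dyadic_geomE -/q /h mulrBr mulr1 mulrA subrK.
have hq : 2 ^+ k <= cnorm q by have := dyadic_geom_ge k 0 sz nz; rewrite mul1r.
have le2 : cnorm (1 - z ^+ (2 ^ k.+1)) <= 2.
  rewrite (le_trans (cnormB _ _)) // cnorm1 -[2]/(1 + 1) lerD2l.
  by rewrite (le_trans (cnormX_le _ _)) // nz expr1n.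
have : cnorm q <= cnorm q * cnorm h + 2 * cnorm y.
  rewrite {1}qE (le_trans (cnormD _ _)) // lerD ?cnormM //.
  by rewrite (le_trans (cnormM _ _)) // ler_wpM2r ?cnorm_ge0.
have : cnorm q * cnorm h <= cnorm q * 2^-1 by rewrite ler_wpM2l ?cnorm_ge0 ?ltW.
have := cnorm_ge0 y; move: hk hq; clear; lra.
Qed.

Definition central A (z : A) : Prop := forall x : A, x * z = z * x.


Lemma center_simple_real A (z : A) : simple_cstar A -> central z ->
  star z = z -> exists r : R, z = r%:C *: 1.
Proof.
move=> simA cz sz; have [z0|z0] := eqVneq (cnorm z) 0.
  by exists 0; rewrite scale0r (cnorm_eq0 _ z0).
have zp : 0 < cnorm z by rewrite lt_neqAle eq_sym z0 cnorm_ge0.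
pose w := ((cnorm z)^-1)%:C *: z.
have zw : z = (cnorm z)%:C *: w by rewrite scalerA -rmorphM /= divff ?scale1r.
have sw : star w = w by rewrite starZr sz.
have nw : cnorm w = 1 by rewrite cnormZr ger0_norm ?invr_ge0 ?cnorm_ge0 ?mulVf.
have cw : central w by move=> x; rewrite -scalerAl -scalerAr cz.
have cw2 : central (1 - w ^+ 2).
  by move=> x; rewrite mulrBl mulrBr mul1r mulr1 expr2 mulrA cw -mulrA cw mulrA.
have w2 : 1 - w ^+ 2 = 0.
  pose I := [set x : A | forall e : R, 0 < e ->
    exists y, cnorm (x - (1 - w ^+ 2) * y) < e].
  have II y : I ((1 - w ^+ 2) * y).
    by move=> e e0; exists y; rewrite subrr cnorm0.
  suff IE : I = [set 0] by have := II 1; rewrite IE mulr1.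
  have [|||||//|IT] := simA I.
  - move=> x hx e e0; have e2 : 0 < e / 2 by rewrite divr_gt0.
    have [x' Ix' xx'] := hx _ e2; have [y hy] := Ix' _ e2; exists y.
    rewrite -(subrK x' x) -addrA (le_lt_trans (cnormD _ _)) //.
    by rewrite [e]splitr ltrD.
  - by have := II 0; rewrite mulr0.
  - move=> x x' Ix Ix' e e0; have e2 : 0 < e / 2 by rewrite divr_gt0.
    have [y hy] := Ix _ e2; have [y' hy'] := Ix' _ e2; exists (y + y').
    rewrite mulrDr opprD addrACA (le_lt_trans (cnormD _ _)) //.
    by rewrite [e]splitr ltrD.
  - move=> a x Ix e e0.
    have ap : 0 < cnorm a + 1 by rewrite ltr_wpDl ?cnorm_ge0.
    have [y hy] := Ix _ (divr_gt0 e0 ap); exists (a * y).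
    rewrite mulrA -cw2 -mulrA -mulrBr (le_lt_trans (cnormM _ _)) //.
    rewrite ltr_pdivlMr // mulrC in hy; apply: le_lt_trans hy.
    by rewrite ler_wpM2r ?cnorm_ge0 // lerDl.
  - move=> a x Ix e e0.
    have ap : 0 < cnorm a + 1 by rewrite ltr_wpDl ?cnorm_ge0.
    have [y hy] := Ix _ (divr_gt0 e0 ap); exists (y * a).
    rewrite mulrA -mulrBl (le_lt_trans (cnormM _ _)) //.
    rewrite ltr_pdivlMr // in hy; apply: le_lt_trans hy.
    by rewrite ler_wpM2l ?cnorm_ge0 // lerDl.
  - have : I 1 by rewrite IT.
    have i2 : 0 < 2^-1 :> R by rewrite invr_gt0.
    move=> /(_ _ i2)[y]; rewrite ltNge => /negP[].
    exact: approx_inv_sqr_ge.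
pose J := [set x : A | (1 + w) * x = 0].
have J1 : J (1 - w).
  by rewrite /J /= mulrDl mul1r mulrBr mulr1 addrA subrK -expr2.
have [|||||JE|JT] := simA J.
- move=> x hx; apply: cnorm_le_eq0 => e e0.
  have ap : 0 < cnorm (1 + w) + 1 by rewrite ltr_wpDl ?cnorm_ge0.
  have [y Jy hy] := hx _ (divr_gt0 e0 ap).
  rewrite -(subrK y x) mulrDr Jy addr0 (le_trans (cnormM _ _)) //.
  rewrite ltr_pdivlMr // mulrC in hy; apply: le_trans (ltW hy).
  by rewrite ler_wpM2r ?cnorm_ge0 // lerDl.
- by rewrite /J /= mulr0.
- by move=> x y; rewrite /J /= => Jx Jy; rewrite mulrDr Jx Jy addr0.
- move=> a x; rewrite /J /= => Jx; rewrite mulrA.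
  have -> : (1 + w) * a = a * (1 + w) by rewrite mulrDl mulrDr mul1r mulr1 cw.
  by rewrite -mulrA Jx mulr0.
- by move=> a x; rewrite /J /= mulrA => ->; rewrite mul0r.
- move: J1; rewrite JE => /eqP; rewrite subr_eq0 => /eqP w1.
  by exists (cnorm z); rewrite {1}zw -w1.
- have : J 1 by rewrite JT.
  rewrite /J /= mulr1 => /eqP; rewrite addrC addr_eq0 => /eqP w1.
  by exists (- cnorm z); rewrite {1}zw w1 scalerN rmorphN scaleNr.
Qed.

Lemma center_simple A (z : A) : simple_cstar A -> central z ->
  exists c : R[i], z = c *: 1.
Proof.
move=> simA cz.
have csz : central (star z).
  by move=> x; rewrite -[x]starK -!starM cz.
have [r hr] : exists r : R, cre z = r%:C *: 1.
  apply: center_simple_real => //; last exact: star_cre.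
  by move=> x; rewrite -scalerAl -scalerAr mulrDl mulrDr cz csz.
have [s hs] : exists s : R, cim z = s%:C *: 1.
  apply: center_simple_real => //; last exact: star_cim.
  by move=> x; rewrite -!scalerAl -!scalerAr mulrBl mulrBr cz csz.
by exists (r%:C + 'i%C * s%:C); rewrite [z]cre_cimE hr hs scalerA -scalerDl.
Qed.

Lemma neumann A (k : A) : cnorm k <= 2^-1 ->
  exists l, [/\ (1 - k) * l = 1, l * (1 - k) = 1 & cnorm l <= 2].
Proof.
move=> hk; pose S n : A := iter n (fun s => 1 + k * s) 0.
have S2 n : cnorm (S n) <= 2.
  elim: n => [|n IHn]; first by rewrite /= cnorm0.
  rewrite /= (le_trans (cnormD _ _)) // cnorm1 -[2]/(1 + 1) lerD2l.
  rewrite (le_trans (cnormM _ _)) // -(@mulVf R 2) ?pnatr_eq0 //.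
  by rewrite ler_pM ?cnorm_ge0.
have comS n : k * S n = S n * k.
  elim: n => [|n IHn]; first by rewrite mulr0 mul0r.
  by rewrite /= mulrDr mulrDl mulr1 mul1r {1}IHn mulrA.
have SE n : (1 - k) * S n = 1 - k ^+ n.
  elim: n => [|n IHn]; first by rewrite /= mulr0 expr0 subrr.
  rewrite /= mulrDr mulr1 mulrA; have -> : (1 - k) * k = k * (1 - k).
    by rewrite mulrBl mulrBr mul1r mulr1.
  by rewrite -mulrA IHn mulrBr mulr1 addrA subrK exprS.
have Sadd m n : S (m + n)%N - S m = k ^+ m * S n.
  elim: m => [|m IHm]; first by rewrite subr0 mul1r.
  by rewrite /= opprD addrACA subrr add0r -mulrBr IHm exprS mulrA.
have powk n : cnorm (k ^+ n) <= 2^-1 ^+ n.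
  rewrite (le_trans (cnormX_le _ _)) //.
  by rewrite lerXn2r ?nnegrE ?cnorm_ge0 ?invr_ge0.
have pow0 (e : R) : 0 < e -> exists n, forall m, (n <= m)%N -> 2 * 2^-1 ^+ m < e.
  move=> e0; have := archi_boundP (divr_ge0 (ler0n R 2) (ltW e0)).
  set n := Num.bound _ => hn; exists n => m nm.
  rewrite exprVn ltr_pdivrMr ?exprn_gt0 // mulrC -ltr_pdivrMr //.
  apply: lt_le_trans hn _; rewrite -natrX ler_nat.
  by rewrite (leq_trans nm) // ltnW // ltn_expl.
have diffS m n : (m <= n)%N -> cnorm (S n - S m) <= 2 * 2^-1 ^+ m.
  move=> /subnKC <-; rewrite Sadd mulrC (le_trans (cnormM _ _)) //.
  by rewrite ler_pM ?cnorm_ge0.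
have [l hl] : exists l : A, (fun n => cnorm (S n - l)) @ \oo --> (0 : R).
  apply: cnorm_complete => e /pow0[N hN]; exists N => m n Nm Nn.
  have [mn|/ltnW nm] := leqP m n; last first.
    exact: le_lt_trans (diffS _ _ nm) (hN _ Nn).
  by rewrite -opprB cnormN; apply: le_lt_trans (diffS _ _ mn) (hN _ Nm).
have Sl e : 0 < e -> exists n, cnorm (S n - l) <= e /\ cnorm (k ^+ n) <= e.
  move=> e0; have [N hN] := pow0 _ e0.
  have /cvgrPdist_lt/(_ _ e0)[M _ hM] := hl; exists (maxn N M); split.
    have := hM _ (leq_maxr N M); rewrite /= sub0r normrN ger0_norm ?cnorm_ge0 //.
    exact: ltW.
  apply: le_trans (powk _) _; apply: le_trans (ltW (hN _ (leq_maxl N M))).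
  by rewrite ler_peMl ?exprn_ge0 ?invr_ge0 ?ler1n.
have kl : k * l = l * k.
  apply/eqP; rewrite -subr_eq0; apply/eqP/cnorm_le_eq0 => e e0.
  have [n [hn _]] := Sl _ e0.
  have -> : k * l - l * k = (S n - l) * k - k * (S n - l).
    by rewrite mulrBl mulrBr comS opprB [RHS]addrC addrA subrK.
  rewrite (le_trans (cnormB _ _)) //.
  have := cnormM (S n - l) k; have := cnormM k (S n - l).
  have : cnorm k * cnorm (S n - l) <= 2^-1 * e by rewrite ler_pM ?cnorm_ge0.
  by rewrite [cnorm (S n - l) * _]mulrC; clear; lra.
have lE : (1 - k) * l = 1.
  apply/eqP; rewrite -subr_eq0; apply/eqP/cnorm_le_eq0 => e e0.
  have [n [h1 h2]] := Sl (e / 3) (divr_gt0 e0 (ltr0n R 3)).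
  have -> : (1 - k) * l - 1 = - (1 - k) * (S n - l) - k ^+ n.
    by rewrite mulNr mulrBr opprB SE -addrA -opprD subrK.
  rewrite (le_trans (cnormB _ _)) //.
  have := cnormM (- (1 - k)) (S n - l); rewrite cnormN.
  have : cnorm (1 - k) * cnorm (S n - l) <= 2 * (e / 3).
    rewrite ler_pM ?cnorm_ge0 // (le_trans (cnormB _ _)) // cnorm1.
    by move: hk; clear; lra.
  by move: h2; clear; lra.
exists l; split => //; first by rewrite mulrBr mulr1 -kl -{1}[l]mul1r -mulrBl.
have : cnorm l <= 1 + cnorm k * cnorm l.
  have {1}-> : l = 1 + k * l by rewrite -lE mulrBl mul1r subrK.
  by rewrite (le_trans (cnormD _ _)) // cnorm1 lerD2l cnormM.
have : cnorm k * cnorm l <= 2^-1 * cnorm l by rewrite ler_wpM2r ?cnorm_ge0.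
by clear; lra.
Qed.

Lemma cnorm_shift_ge A (a u : A) (c : R) : 0 <= c -> star a = a ->
  star u = u -> a * u = u * a ->
  c * cnorm u <= cnorm ((c%:C *: 1 + a ^+ 2) * u).
Proof.
move=> c0 sa su au; have [->|u0] := eqVneq (cnorm u) 0.
  by rewrite mulr0 cnorm_ge0.
have up : 0 < cnorm u by rewrite lt_neqAle eq_sym u0 cnorm_ge0.
rewrite -(ler_pM2r up) -mulrA -expr2.
pose v := (Num.sqrt c)%:C *: u.
have sv : star v = v by rewrite starZr su.
have sau : star (a * u) = a * u by rewrite starM sa su au.
have cuv : v * (a * u) = a * u * v.
  by rewrite -scalerAl -scalerAr mulrA -au.
have := cnorm_real_le sv sau cuv.
have -> : v ^+ 2 + (a * u) ^+ 2 = ((c%:C *: 1 + a ^+ 2) * u) * u.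
  have -> : v ^+ 2 = c%:C *: (u * u).
    by rewrite expr2 -scalerAl -scalerAr scalerA -rmorphM -expr2 sqr_sqrtr.
  have -> : (a * u) ^+ 2 = a ^+ 2 * u * u.
    by rewrite !expr2 -!mulrA; congr (_ * _); rewrite !mulrA au.
  by rewrite !mulrDl -!scalerAl mul1r.
rewrite cnormZr exprMn real_normK ?num_real // sqr_sqrtr // => /le_trans; apply.
exact: cnormM.
Qed.

Lemma cnorm_one_sub_sqr A (a : A) : star a = a -> cnorm a <= 1 ->
  cnorm (1 - a ^+ 2) <= 1.
Proof.
move=> sa na; set y := 1 - a ^+ 2; set r := cnorm y.
rewrite leNgt; apply/negP => r1.
have r0 : 0 < r by apply: lt_trans r1.
have sy : star y = y by rewrite starB star1 starX.
pose z := (r^-1)%:C *: y.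
have sz : star z = z by rewrite starZr sy.
have nz : cnorm z = 1 by rewrite cnormZr ger0_norm ?invr_ge0 ?ltW // mulVf ?gt_eqF.
have yz : y = r%:C *: z.
  by rewrite scalerA -rmorphM /= divff ?gt_eqF // scale1r.
have ay : GRing.comm a y by apply: commrB; [apply: commr1 | apply: commrX].
have az : GRing.comm a z by rewrite /GRing.comm -scalerAl -scalerAr ay.
have ag k : GRing.comm a (dyadic_geom z k).
  elim: k => [|k IHk]; first exact: commr1.
  by apply: commrM => //; apply: commrD; [apply: commr1 | apply: commrX].
have zg k : GRing.comm z (dyadic_geom z k).
  elim: k => [|k IHk]; first exact: commr1.
  by apply: commrM => //; apply: commrD; [apply: commr1 | apply: commrX].
have sg k : star (dyadic_geom z k) = dyadic_geom z k.
  elim: k => [|k IHk]; first by rewrite star1.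
  rewrite /= starM IHk starD star1 starX //.
  by apply: commr_sym; apply: commrD; [apply: commr1 | apply/commrX/commr_sym/zg].
have key k : (r - 1) * (r * 2 ^+ k) <= r ^+ 2 * 2.
  set g := dyadic_geom z k; pose u := r%:C *: g + y * g.
  have gk : 2 ^+ k <= cnorm g by have := dyadic_geom_ge k 0 sz nz; rewrite mul1r.
  have su : star u = u.
    by rewrite /u starD starZr starM sg yz starZr sz -scalerAl -scalerAr zg.
  have au : a * u = u * a.
    apply: commrD; first by rewrite /GRing.comm -scalerAl -scalerAr ag.
    by apply: commrM; [exact: ay | exact: ag].
  have := cnorm_shift_ge (_ : 0 <= r - 1) sa su au; rewrite subr_ge0 ltW // => /(_ isT).
  have -> : ((r - 1)%:C *: 1 + a ^+ 2) * u = (r ^+ 2)%:C *: (1 - z ^+ (2 ^ k.+1)).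
    have -> : (r - 1)%:C *: 1 + a ^+ 2 = r%:C *: (1 - z).
      by rewrite scalerBr -yz rmorphB scalerBl scale1r opprB addrA addrAC.
    have -> : u = r%:C *: (g + z * g) by rewrite /u yz -scalerAl scalerDr.
    rewrite -dyadic_geomE -/g -scalerAl -scalerAr scalerA -rmorphM -expr2.
    congr (_ *: _); rewrite mulrBl mul1r mulrDr mulrBr mulr1 mulrA -expr2 opprD.
    by rewrite addrA addrK (commrX 2 (commr_sym (zg k))).
  rewrite cnormZr ger0_norm ?exprn_ge0 ?(ltW r0) // => h.
  have h2 : cnorm (1 - z ^+ (2 ^ k.+1)) <= 2.
    rewrite (le_trans (cnormB _ _)) // cnorm1 -[2]/(1 + 1) lerD2l.
    by rewrite (le_trans (cnormX_le _ _)) // nz expr1n.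
  apply: le_trans (ler_wpM2l _ h2); last by rewrite exprn_ge0 ?(ltW r0).
  apply: le_trans h; rewrite ler_pM2l ?subr_gt0 //.
  have -> : u = (r + 1)%:C *: g - a ^+ 2 * g.
    by rewrite /u mulrBl mul1r rmorphD scalerDl scale1r addrA.
  have : cnorm ((r + 1)%:C *: g) - cnorm (a ^+ 2 * g)
      <= cnorm ((r + 1)%:C *: g - a ^+ 2 * g).
    by rewrite lerBlDr -{1}(subrK (a ^+ 2 * g) (_ *: _)) cnormD.
  have : cnorm (a ^+ 2 * g) <= 1 * cnorm g.
    rewrite (le_trans (cnormM _ _)) // ler_wpM2r ?cnorm_ge0 //.
    by rewrite cnorm_sqr // expr_le1 ?cnorm_ge0.
  rewrite cnormZr ger0_norm ?addr_ge0 ?(ltW r0) //.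
  have : r * 2 ^+ k <= r * cnorm g by rewrite ler_pM2l.
  by rewrite [(r + 1) * _]mulrDl; clear; lra.
have [k hk] : exists k : nat, r ^+ 2 * 2 / ((r - 1) * r) < 2 ^+ k.
  have c0 : 0 <= r ^+ 2 * 2 / ((r - 1) * r).
    by rewrite divr_ge0 ?mulr_ge0 ?exprn_ge0 ?subr_ge0 // ltW.
  have := archi_boundP c0.
  set k := Num.bound _ => hk; exists k; apply: lt_le_trans hk _.
  by rewrite -natrX ler_nat ltnW // ltn_expl.
have := key k; rewrite mulrA leNgt => /negP[].
by rewrite [ltRHS]mulrC -ltr_pdivrMr // mulr_gt0 ?subr_gt0.
Qed.

Lemma star_mul_scalar_ge0 A (q : A) (c : R) : star q * q = c%:C *: 1 -> 0 <= c.
Proof.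
move=> h; rewrite leNgt; apply/negP => c0.
wlog c1 : q c h c0 / c = -1 => [hw|].
  pose d := Num.sqrt (- c).
  have d0 : d != 0 by rewrite sqrtr_eq0 -ltNge oppr_gt0.
  have dd : d * d = - c by rewrite -expr2 sqr_sqrtr // oppr_ge0 ltW.
  apply: (hw (d^-1%:C *: q) (-1)) => //.
  rewrite starZr -scalerAl -scalerAr h !scalerA -!rmorphM -invfM dd.
  by rewrite invrN mulNr mulVf // lt_eqF.
move: h; rewrite c1 rmorphN scaleN1r => h {c c0 c1}.
have q1 : cnorm q = 1.
  have := cnorm_star q; rewrite h cnormN cnorm1 => /esym/eqP.
  by rewrite sqrp_eq1 ?cnorm_ge0 // => /eqP.
have hn (x : A) : cnorm x <= 2 -> cnorm ((2^-1)%:C *: x) <= 1.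
  move=> x2; rewrite cnormZr ger0_norm ?invr_ge0 //.
  by rewrite mulrC ler_pdivrMr // mul1r.
have n1 : cnorm (cre q) <= 1.
  apply: hn; rewrite (le_trans (cnormD _ _)) // cnorm_starE q1.
  by rewrite -[2]/(1 + 1).
have n2 : cnorm (cim q) <= 1.
  apply: hn; rewrite cnormZ normc_def /= expr0n expr1n add0r sqrtr1 mul1r.
  by rewrite (le_trans (cnormB _ _)) // cnorm_starE q1.
set s := - (q * star q).
have ss : s * s = s.
  by rewrite mulrNN mulrA -(mulrA q) h mulrN1 mulNr.
have sas : star s = s by rewrite starN starM starK.
have reim : cre q ^+ 2 + cim q ^+ 2 = (2^-1)%:C *: (star q * q - s).
  have ii : 'i%C * 'i%C = -1 :> R[i] by rewrite -expr2 sqr_i.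
  have hZ (x : A) : ((2^-1)%:C *: x) ^+ 2 = (2^-1)%:C *: ((2^-1)%:C *: (x * x)).
    by rewrite expr2 -scalerAl -scalerAr.
  rewrite opprK !hZ -!scalerDr -scalerAl -scalerAr (scalerA 'i%C) ii scaleN1r.
  congr (_ *: _); rewrite !mulrDl !mulrDr !mulNr !mulrN opprK.
  set a := q * q; set b := star q * star q; set c := q * star q.
  set d := star q * q.
  have -> : a + c + (d + b) - (b - d + (- c + a)) = (d + c) *+ 2.
    have -> : a + c + (d + b) = a + b + (d + c).
      by rewrite [d + b]addrC addrACA [c + d]addrC.
    have -> : b - d + (- c + a) = a + b - (d + c).
      by rewrite [- c + a]addrC addrACA [b + a]addrC opprD.
    by rewrite opprB addrC addrA subrK mulr2n.
  rewrite -[(d + c) *+ 2]scaler_nat scalerA -(rmorph_nat (real_complex R)) -rmorphM.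
  by rewrite mulVf ?pnatr_eq0 // scale1r.
have h52 : cnorm ((1 - cre q ^+ 2) + (1 - cim q ^+ 2)) <= 2.
  rewrite (le_trans (cnormD _ _)) // -[2]/(1 + 1).
  by rewrite lerD // cnorm_one_sub_sqr ?star_cre ?star_cim.
have r1 : star ((Num.sqrt (5 / 2))%:C *: 1 : A) = (Num.sqrt (5 / 2))%:C *: 1.
  by rewrite starZr star1.
have r2 : star ((Num.sqrt 2^-1)%:C *: s) = (Num.sqrt 2^-1)%:C *: s.
  by rewrite starZr sas.
have rr (t : R) (x : A) : 0 <= t ->
    ((Num.sqrt t)%:C *: x) ^+ 2 = t%:C *: (x * x).
  by move=> t0; rewrite expr2 -scalerAl -scalerAr scalerA -rmorphM -expr2 sqr_sqrtr.
have := cnorm_real_le r1 r2.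
rewrite -!scalerAl -!scalerAr mul1r mulr1 scalerA mulrC -scalerA => /(_ erefl).
rewrite !rr ?divr_ge0 ?invr_ge0 // ss mulr1 cnormZr cnorm1 mulr1 real_normK ?num_real //.
rewrite sqr_sqrtr ?divr_ge0 //.
have <- : (1 - cre q ^+ 2) + (1 - cim q ^+ 2) = (5 / 2)%:C *: 1 + (2^-1)%:C *: s.
  rewrite addrACA -opprD reim h.
  rewrite -opprD scalerN opprK scalerDr addrA; congr (_ + _).
  have -> : 5 / 2 = 1 + 1 + 2^-1 :> R by clear; lra.
  by rewrite !rmorphD rmorph1 !scalerDl scale1r.
by move: h52; clear; lra.
Qed.

End CStarAlgebras.

(** * Inclusions, conditional expectations and basic constructions *)

Section Inclusions.
Context {R : realType} {B A : cstarType R} (i : B -> A).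
Hypothesis hi : cstar_inclusion i.

Lemma inclP (c : R[i]) x y : i (c *: x + y) = c *: i x + i y.
Proof. by case: hi => h _ _ _; rewrite h. Qed.

Lemma inclD x y : i (x + y) = i x + i y.
Proof. by rewrite -[x]scale1r inclP !scale1r. Qed.

Lemma incl0 : i 0 = 0.
Proof. by apply: (addrI (i 0)); rewrite -inclD !addr0. Qed.

Lemma inclZ (c : R[i]) x : i (c *: x) = c *: i x.
Proof. by rewrite -[c *: x]addr0 inclP incl0 addr0. Qed.

Lemma inclN x : i (- x) = - i x.
Proof. by rewrite -scaleN1r inclZ scaleN1r. Qed.

Lemma inclB x y : i (x - y) = i x - i y.
Proof. by rewrite inclD inclN. Qed.

Lemma incl_sum I (s : seq I) (F : I -> B) :
  i (\sum_(k <- s) F k) = \sum_(k <- s) i (F k).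
Proof. exact: (big_morph i inclD incl0). Qed.

Lemma incl1 : i 1 = 1.
Proof. by case: hi => _ [h _] _ _. Qed.

Lemma inclM x y : i (x * y) = i x * i y.
Proof. by case: hi => _ [_ h] _ _; rewrite h. Qed.

Lemma incl_star x : i (star x) = star (i x).
Proof. by case: hi. Qed.

Lemma incl_inj : injective i.
Proof. by case: hi. Qed.

Section ConditionalExpectations.
Variable E : A -> B.
Hypothesis hE : cond_exp i E.

Lemma condP (c : R[i]) x y : E (c *: x + y) = c *: E x + E y.
Proof. by apply: incl_inj; case: hE => _ h _ _ _; rewrite inclP; apply: h. Qed.

Lemma condD x y : E (x + y) = E x + E y.
Proof. by rewrite -[x]scale1r condP !scale1r. Qed.

Lemma cond0 : E 0 = 0.
Proof. by apply: (addrI (E 0)); rewrite -condD !addr0. Qed.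

Lemma condZ (c : R[i]) x : E (c *: x) = c *: E x.
Proof. by rewrite -[c *: x]addr0 condP cond0 addr0. Qed.

Lemma condN x : E (- x) = - E x.
Proof. by rewrite -scaleN1r condZ scaleN1r. Qed.

Lemma condB x y : E (x - y) = E x - E y.
Proof. by rewrite condD condN. Qed.

Lemma cond_sum I (s : seq I) (F : I -> A) :
  E (\sum_(k <- s) F k) = \sum_(k <- s) E (F k).
Proof. exact: (big_morph E condD cond0). Qed.

Lemma condK b : E (i b) = b.
Proof. by apply: incl_inj; case: hE => _ _ _ h _; apply: h; exists b. Qed.

Lemma condMl b x : E (i b * x) = b * E x.
Proof.
by apply: incl_inj; case: hE => _ _ _ _ h; rewrite inclM; apply h; first exists b.
Qed.

Lemma condMr b x : E (x * i b) = E x * b.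
Proof.
by apply: incl_inj; case: hE => _ _ _ _ h; rewrite inclM; apply h; first exists b.
Qed.

Lemma cond1 : E 1 = 1.
Proof. by rewrite -incl1 condK. Qed.

Lemma cond_pos x : exists q, E (star x * x) = star q * q.
Proof.
case: hE => _ _ /(_ x Logic.I)[_ [q _ <-] h] _ _; exists q; apply: incl_inj.
by rewrite inclM incl_star.
Qed.

Lemma cond_star x : E (star x) = star (E x).
Proof.
have sa y : E y + E (star y) = star (E y) + star (E (star y)).
  have [p hp] := cond_pos (1 + y); have [q hq] := cond_pos y.
  have : star (E (star (1 + y) * (1 + y))) = E (star (1 + y) * (1 + y)).
    by rewrite hp starM starK.
  have sq : star (E (star y * y)) = E (star y * y) by rewrite hq starM starK.
  rewrite starD star1 mulrDl mul1r mulrDr mulr1 !condD cond1 !starD star1 sq.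
  by rewrite !addrA => /addIr; rewrite -!addrA => /addrI ->.
have h1 := sa x; have := sa ('i%C *: x).
rewrite !(starZ, condZ) conjc_i rmorphN /= conjc_i opprK !scaleNr.
rewrite -scalerBr [RHS]addrC -scalerBr => h2.
have {}h2 : E x - E (star x) = star (E (star x)) - star (E x).
  have := congr1 ( *:%R (- 'i%C)) h2; rewrite !scalerA mulNr -expr2 sqr_i opprK.
  by rewrite !scale1r.
have : E x + E x = star (E (star x)) + star (E (star x)).
  have -> : E x + E x = (E x + E (star x)) + (E x - E (star x)).
    by rewrite addrACA subrr addr0.
  by rewrite h1 h2 [star (E x) + _]addrC addrACA subrr addr0.
move=> /(congr1 (fun y => (2^-1)%:C *: y)); rewrite !half_double => ->.
by rewrite starK.
Qed.

End ConditionalExpectations.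

End Inclusions.

Definition nondegenerate {R : realType} {B A : cstarType R} (E : A -> B) :=
  forall z, (forall x, E (x * z) = 0) -> z = 0.

Section BasicConstruction.
Context {R : realType} {B A M : cstarType R}.
Variables (i : B -> A) (E : A -> B) (j : A -> M) (e : M).
Hypotheses (hi : cstar_inclusion i) (hj : cstar_inclusion j).
Hypotheses (hE : cond_exp i E) (hM : basic_construction i E j e).

Lemma jones_span m : exists s : seq (A * A),
  m = \sum_(p <- s) j p.1 * e * j p.2.
Proof. by case: hM => ? []. Qed.

Lemma jones_idem : e * e = e.
Proof.
case: hM => act [_ [_ actM act_inj] _ acte _]; apply: act_inj.
by apply/funext => x; rewrite actM !acte (condK hi hE).
Qed.

Lemma jones_compress x : e * j x * e = j (i (E x)) * e.
Proof.
case: hM => act [_ [_ actM act_inj] actj acte _]; apply: act_inj.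
by apply/funext => y; rewrite !(actM, acte, actj) (condMr hi hE) (inclM hi).
Qed.

Lemma jones_comm b : e * j (i b) = j (i b) * e.
Proof.
case: hM => act [_ [_ actM act_inj] actj acte _]; apply: act_inj.
by apply/funext => y; rewrite !(actM, acte, actj) (condMl hi hE) (inclM hi).
Qed.

Lemma jones_mul_inj a : j a * e = 0 -> a = 0.
Proof.
case: hM => act [[_ _ _] [actP actM _] actj acte _] h.
have := actM (j a) e 1; rewrite h acte actj (cond1 hi hE) (incl1 hi) mulr1 => <-.
by have := actP (- 1) 0 0 1; rewrite scaleN1r oppr0 addr0 scaleN1r addNr.
Qed.

Lemma jones_star : nondegenerate E -> star e = e.
Proof.
move=> nd; case: hM => act [[_ _ adj] [_ _ act_inj] _ acte _]; apply: act_inj.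
apply/funext => y; apply/eqP; rewrite -subr_eq0; apply/eqP/nd => x.
rewrite mulrBr (condB hi hE) -[x]starK -adj !acte.
by rewrite -(incl_star hi) (condMl hi hE) (condMr hi hE) -(cond_star hi hE) subrr.
Qed.

(* [y] acts on [A] as the right multiplication by some [x]. *)
Lemma jones_commutantr y : (forall a, j a * y = y * j a) ->
  exists2 x, (forall b, i b * x = x * i b) & y * e = j x * e.
Proof.
case: hM => act [[_ actb _] [_ actM act_inj] actj acte _] cy.
have actE a : act y a = a * act y 1.
  have := congr1 (fun m => act m 1) (cy a).
  by rewrite !actM !actj mulr1 => ->.
exists (act y 1) => [b|]; first by rewrite -actE -actb mul1r.
apply: act_inj; apply/funext => a; rewrite !(actM, acte, actj).
by rewrite -{1}[i (E a)]mul1r actb.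
Qed.

Section Faithful.
Hypothesis es : star e = e.

Lemma cond_faithful x : E (star x * x) = 0 -> x = 0.
Proof.
move=> h; apply: jones_mul_inj; apply: star_mul_eq0.
rewrite starM es -(incl_star hj) mulrA -[e * _ * _]mulrA -(inclM hj).
by rewrite jones_compress h (incl0 hi) (incl0 hj) mul0r.
Qed.

End Faithful.

Section Dual.
Context {tau : R} {E1 : M -> A}.
Hypothesis hE1 : dual_cond_exp j e tau E1.

Lemma dual_cond : cond_exp j E1. Proof. by case: hE1. Qed.

Lemma dual_condE x y : E1 (j x * e * j y) = tau%:C *: (x * y).
Proof. by case: hE1. Qed.

Lemma dual_cond_jones : E1 e = tau%:C *: 1.
Proof.
by have := dual_condE 1 1; rewrite (incl1 hj) mul1r !mulr1.
Qed.

Lemma pushdownl m : e * j (E1 (e * m)) = tau%:C *: (e * m).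
Proof.
have [s ->] := jones_span m; rewrite mulr_sumr (cond_sum hj dual_cond).
rewrite (incl_sum hj) mulr_sumr scaler_sumr; apply: eq_bigr => p _.
rewrite !mulrA jones_compress dual_condE (inclZ hj) (inclM hj) -scalerAr.
by rewrite mulrA jones_comm.
Qed.

Lemma nondegenerate_dual : tau != 0 -> nondegenerate E1.
Proof.
move=> tau0 z hz; have [s h1] := jones_span 1.
rewrite -[z]mul1r h1 mulr_suml big1 // => p _.
have t0 : tau%:C != 0 :> R[i] by rewrite (inj_eq (@complexI R)).
apply: (scalerI t0); rewrite scaler0 -!mulrA scalerAr -pushdownl.
by rewrite mulrA hz (incl0 hj) !mulr0.
Qed.

End Dual.

End BasicConstruction.

(** * Minimal conditional expectations *)

Lemma sub_sub_addK (V : zmodType) (a y z : V) :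
  a - y - y + z - a + (y + y) = z.
Proof.
rewrite -[a - y - y]addrA -opprD [a - _ + z]addrAC [_ - a + _]addrAC subrK.
by rewrite addrAC subrr add0r.
Qed.

Section Commutants.
Context {R : realType} {A : cstarType R} (S : set A).

Lemma commutant1 : commutant S 1.
Proof. by move=> s _; rewrite mulr1 mul1r. Qed.

Lemma commutantD x y : commutant S x -> commutant S y -> commutant S (x + y).
Proof. by move=> hx hy s Ss; rewrite mulrDl mulrDr hx ?hy. Qed.

Lemma commutantZ (c : R[i]) x : commutant S x -> commutant S (c *: x).
Proof. by move=> hx s Ss; rewrite -scalerAl -scalerAr hx. Qed.

Lemma commutantN x : commutant S x -> commutant S (- x).
Proof. by move=> hx s Ss; rewrite mulNr mulrN hx. Qed.

Lemma commutantB x y : commutant S x -> commutant S y -> commutant S (x - y).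
Proof. by move=> hx hy; apply/commutantD/commutantN. Qed.

Lemma commutantM x y : commutant S x -> commutant S y -> commutant S (x * y).
Proof. by move=> hx hy s Ss; rewrite -mulrA hy // mulrA hx // mulrA. Qed.

Lemma commutant_star x : (forall s, S s -> S (star s)) -> commutant S x ->
  commutant S (star x).
Proof. by move=> hS hx s Ss; rewrite -[s]starK -!starM hx //; apply: hS. Qed.

Lemma commutant_inv x y : x * y = 1 -> y * x = 1 -> commutant S x ->
  commutant S y.
Proof.
move=> xy yx hx s Ss.
by rewrite -[y * s]mulr1 -xy mulrA -[y * s * x]mulrA -hx // !mulrA yx mul1r.
Qed.
End Commutants.

Lemma commutant_rangeE {R : realType} {C : Type} {A : cstarType R} (f : C -> A) x :
  commutant (range f) x <-> forall b, x * f b = f b * x.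
Proof.
by split=> [h b|h _ [b _ <-]]; [apply: h; exists b | apply: h].
Qed.

Lemma scalar_real {R : realType} {A : cstarType R} (z : A) (c : R[i]) :
  star z = z -> z = c *: 1 -> exists r : R, z = r%:C *: 1.
Proof.
move=> sz zc; exists (complex.Re c); rewrite RRe_real //.
apply/CrealP; move: sz; rewrite zc starZ star1 => /eqP.
rewrite -subr_eq0 -scalerBl scaler_eq0 oner_eq0 orbF subr_eq0 => /eqP //.
Qed.

Lemma scalar_inj {R : realType} {A : cstarType R} (r s : R) :
  r%:C *: 1 = s%:C *: 1 :> A -> r = s.
Proof.
move=> /eqP; rewrite -subr_eq0 -scalerBl scaler_eq0 oner_eq0 orbF subr_eq0.
by move=> /eqP/complexI.
Qed.

Lemma first_order {R : realType} (r f f2 p K t0 : R) : 0 < t0 ->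
  (forall t, `|t| <= t0 ->
    r <= (1 + 2 * t * f + t ^+ 2 * f2) * (r - 2 * t * p + t ^+ 2 * K)) ->
  p = r * f.
Proof.
move=> t00 h; pose d := r * f - p.
pose C := `|f2 * r - 4 * f * p + K| + `|2 * f * K - 2 * f2 * p| + `|f2 * K|.
have hC t : `|t| <= t0 -> `|t| <= 1 -> 0 <= 2 * t * d + t ^+ 2 * C.
  move=> tt0 t1; have := h t tt0.
  have -> : (1 + 2 * t * f + t ^+ 2 * f2) * (r - 2 * t * p + t ^+ 2 * K) =
    r + 2 * t * d + t ^+ 2 * ((f2 * r - 4 * f * p + K) +
      t * (2 * f * K - 2 * f2 * p) + t ^+ 2 * (f2 * K)) by rewrite /d; ring.
  set X := _ + _ + t ^+ 2 * (f2 * K).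
  suff XC : X <= C.
    move=> /le_trans le_r; rewrite -(lerDl r) addrA; apply: le_r.
    by rewrite lerD2l ler_wpM2l ?sqr_ge0.
  rewrite /X /C; apply: lerD; first apply: lerD.
  - exact: ler_norm.
  - apply: le_trans (ler_norm _) _; rewrite normrM.
    by rewrite ler_piMl.
  - apply: le_trans (ler_norm _) _; rewrite normrM normrX.
    by rewrite ler_piMl // expr_le1.
have C0 : 0 <= C by rewrite !addr_ge0.
suff d0 : d = 0 by move: d0; rewrite /d; clear; lra.
apply/eqP; rewrite -normr_le0 leNgt; apply/negP => d0.
pose t := Num.min (Num.min t0 1) (`|d| / (C + 1)).
have C1 : 0 < C + 1 by move: C0; clear; lra.
have t_gt0 : 0 < t by rewrite !lt_min t00 ltr01 divr_gt0.
have t_le0 : t <= t0 by rewrite !ge_min lexx.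
have t_le1 : t <= 1 by rewrite !ge_min lexx orbT.
have td : t * (C + 1) <= `|d| by rewrite -ler_pdivlMr // ge_min lexx orbT.
have nt : `|t| = t by rewrite ger0_norm // ltW.
have h1 : 0 <= t * (2 * d + t * C).
  have -> : t * (2 * d + t * C) = 2 * t * d + t ^+ 2 * C by ring.
  by apply: hC; rewrite nt.
have h2 : 0 <= t * (- 2 * d + t * C).
  have -> : t * (- 2 * d + t * C) = 2 * - t * d + (- t) ^+ 2 * C by ring.
  by apply: hC; rewrite normrN nt.
move: h1 h2; rewrite !pmulr_rge0 //.
move: td d0 t_gt0; rewrite mulrDr mulr1; move: (t * C) => tC.
by case: (ler0P d); move: d t {C0 C1 hC t_le0 t_le1 nt} => d' t' ? ; lra.
Qed.

Lemma incl_id {R : realType} (A : cstarType R) : cstar_inclusion (@id A).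
Proof. by split=> //; split. Qed.

Lemma weighted_central {R : realType} {B A C : cstarType R} (i : B -> A)
    (E : A -> B) (j : A -> C) (kap : R[i]) (I : Type) (s : seq I) (w : I -> A)
    (x : C) :
  cstar_inclusion j ->
  (forall y, y = kap *: \sum_(k <- s) w k * i (E (star (w k) * y))) ->
  (forall y, y = kap *: \sum_(k <- s) i (E (y * w k)) * star (w k)) ->
  (forall b, x * j (i b) = j (i b) * x) ->
  forall a, j a * (\sum_(k <- s) j (w k) * x * j (star (w k))) =
    (\sum_(k <- s) j (w k) * x * j (star (w k))) * j a.
Proof.
move=> hj hs hs' hx a; rewrite mulr_sumr mulr_suml.
transitivity (\sum_(k <- s) \sum_(l <- s) kap *: (j (w l) *
    x * (j (i (E (star (w l) * a * w k))) * j (star (w k))))).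
  apply: eq_bigr => k _; rewrite !mulrA -(inclM hj) {1}[a * w k]hs.
  rewrite (inclZ hj) (incl_sum hj) -!scalerAl !mulr_suml scaler_sumr.
  apply: eq_bigr => l _; rewrite (inclM hj) -[star (w l) * a * w k]mulrA.
  by congr (_ *: _); rewrite -!mulrA; congr (_ * _); rewrite !mulrA hx.
rewrite exchange_big /=; apply: eq_bigr => l _.
rewrite -[RHS]mulrA -(inclM hj) [star (w l) * a in RHS]hs' (inclZ hj).
rewrite (incl_sum hj) -scalerAr mulr_sumr scaler_sumr.
by apply: eq_bigr => k _; rewrite (inclM hj).
Qed.

Section MinimalExpectation.
Context {R : realType} {B A : cstarType R} (i : B -> A) (E : A -> B).
Hypotheses (hi : cstar_inclusion i) (simB : simple_cstar B).

Let relcomm := commutant (range i).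

Lemma relcomm_star x : relcomm x -> relcomm (star x).
Proof.
apply: commutant_star => _ [b _ <-]; exists (star b) => //.
by rewrite (incl_star hi).
Qed.

Lemma cond_relcomm_scalar x : cond_exp i E -> relcomm x ->
  exists c, E x = c *: 1.
Proof.
move=> hE /commutant_rangeE hx; apply: center_simple => // b.
by rewrite -(condMl hi hE) -hx (condMr hi hE).
Qed.

Lemma twisted_cond_exp (g : A) (c : R) : cond_exp i E -> 0 < c ->
  relcomm g -> star g = g -> E (g * g) = c%:C *: 1 ->
  cond_exp i (fun x => c^-1%:C *: E (g * x * g)).
Proof.
move=> hE c0 /commutant_rangeE hg sg gg; have cc : c^-1%:C * c%:C = 1 :> R[i].
  by rewrite -rmorphM mulVf ?gt_eqF.
split.
- by move=> x _; eexists.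
- move=> a x y _ _ /=; rewrite mulrDr mulrDl -scalerAr -scalerAl.
  rewrite (condP hi hE) scalerDr (inclD hi) scalerA mulrC -scalerA.
  by rewrite (inclZ hi).
- move=> x _; have [q hq] := cond_pos hi hE (x * g).
  have cI : (Num.sqrt c^-1)%:C * (Num.sqrt c^-1)%:C = c^-1%:C :> R[i].
    by rewrite -rmorphM -expr2 sqr_sqrtr // invr_ge0 ltW.
  exists (i ((Num.sqrt c^-1)%:C *: q)); first by eexists.
  rewrite -(incl_star hi) -(inclM hi) starZr -scalerAl -scalerAr scalerA cI -hq.
  by rewrite /= starM sg !mulrA.
- move=> _ [b _ <-] /=; rewrite hg -mulrA (condMl hi hE) gg -scalerAr mulr1.
  by rewrite scalerA cc scale1r.
- move=> _ x [b _ <-] _ /=; split.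
    by rewrite mulrA hg -!mulrA (condMl hi hE) scalerAr (inclM hi).
  by rewrite mulrA -[_ * i b * g]mulrA -hg mulrA (condMr hi hE) scalerAl (inclM hi).
Qed.

Lemma twisted_index (g l : A) (c r : R) (s : seq A) : cond_exp i E -> 0 < c ->
  relcomm g -> star g = g -> g * l = 1 -> l * g = 1 ->
  quasi_basis i E s ->
  \sum_(k <- s) k * (l * l) * star k = r%:C *: 1 ->
  has_index i (fun x => c^-1%:C *: E (g * x * g)) (c * r).
Proof.
move=> hE c0 hg sg gl lg hs hr.
have cc : c%:C * c^-1%:C = 1 :> R[i] by rewrite -rmorphM divff ?gt_eqF.
have /commutant_rangeE hl := commutant_inv gl lg hg.
have sl : star l = l.
  have := congr1 star gl; rewrite starM sg star1 => h.
  by rewrite -[star l]mulr1 -gl mulrA h mul1r.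
pose d := (Num.sqrt c)%:C : R[i].
have dd : d * d = c%:C by rewrite -rmorphM -expr2 sqr_sqrtr // ltW.
have sd (y : A) : star (d *: y) = d *: star y by exact: starZr.
have ddc : d * (c^-1%:C * d) = 1 by rewrite mulrCA dd mulrC cc.
exists [seq d *: (k * l) | k <- s] => [x|]; last first.
  rewrite rmorphM -scalerA -hr scaler_sumr big_map; apply: eq_bigr => k _.
  by rewrite sd starM sl -scalerAl -scalerAr scalerA dd !mulrA.
rewrite !big_map; split.
- transitivity ((\sum_(k <- s) k * i (E (star k * (x * g)))) * l).
    by have [<- _] := hs (x * g); rewrite -mulrA gl mulr1.
  rewrite mulr_suml; apply: eq_bigr => k _.
  rewrite sd starM sl -!scalerAl -!scalerAr -scalerAl (condZ hi hE) !(inclZ hi).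
  rewrite -!scalerAr !scalerA -mulrA ddc scale1r !mulrA gl mul1r.
  by rewrite -!mulrA hl !mulrA.
- transitivity (l * (\sum_(k <- s) i (E (g * x * k)) * star k)).
    by have [_ <-] := hs (g * x); rewrite mulrA lg mul1r.
  rewrite mulr_sumr; apply: eq_bigr => k _.
  rewrite sd starM sl -!scalerAr -!scalerAl (condZ hi hE) !(inclZ hi).
  rewrite -!scalerAl !scalerA -mulrA ddc scale1r.
  by rewrite -!mulrA lg mulr1 !mulrA hl.
Qed.

Section QuasiBasis.
Variable s : seq A.
Hypotheses (hE : cond_exp i E) (hs : quasi_basis i E s).
Hypothesis simA : simple_cstar A.

Lemma quasi_basis_central x : relcomm x ->
  central (\sum_(k <- s) k * x * star k).
Proof.
move=> /commutant_rangeE hx; apply: (@weighted_central _ _ _ _ i E id 1) => //.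
- exact: incl_id.
- by move=> y; rewrite scale1r; case: (hs y).
- by move=> y; rewrite scale1r; case: (hs y).
Qed.

Lemma quasi_basis_bound x :
  cnorm (\sum_(k <- s) k * x * star k)
    <= (\sum_(k <- s) cnorm k ^+ 2) * cnorm x.
Proof.
rewrite (le_trans (cnorm_sum _ _)) // mulr_suml ler_sum // => k _.
rewrite (le_trans (cnormM _ _)) // cnorm_starE expr2 mulrAC.
by rewrite ler_wpM2r ?cnorm_ge0 ?cnormM.
Qed.

Lemma relcomm_cond_real x : star x = x -> relcomm x ->
  exists f : R, E x = f%:C *: 1.
Proof.
move=> sx /(cond_relcomm_scalar hE)[c hc]; apply: scalar_real hc.
by rewrite -(cond_star hi hE) sx.
Qed.

Lemma quasi_basis_real x : star x = x -> relcomm x ->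
  exists p : R, \sum_(k <- s) k * x * star k = p%:C *: 1.
Proof.
move=> sx hx; have [c hc] := center_simple simA (quasi_basis_central hx).
apply: scalar_real hc; rewrite raddf_sum /=; apply: eq_bigr => k _.
by rewrite !starM starK sx mulrA.
Qed.

End QuasiBasis.

End MinimalExpectation.

(* Minimality says that the derivative at [t = 0] of the index of
   [twisted_cond_exp] for [g = 1 + t *: x] vanishes. *)
Lemma minimal_quasi_basis_real {R : realType} {B A : cstarType R} (i : B -> A)
    (E : A -> B) s (r : R) x :
  cstar_inclusion i -> simple_cstar B -> simple_cstar A ->
  minimal_cond_exp i E -> quasi_basis i E s ->
  \sum_(k <- s) k * star k = r%:C *: 1 ->
  star x = x -> commutant (range i) x ->
  \sum_(k <- s) k * x * star k = r%:C *: i (E x).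
Proof.
move=> hi simB simA [hE _ hmin] hs hr sx hx.
have relcomm_cond_real := relcomm_cond_real hi simB hE.
have quasi_basis_real := quasi_basis_real hs simA.
have [f hf] := relcomm_cond_real _ sx hx.
have sxx : star (x * x) = x * x by rewrite starM sx.
have [f2 hf2] := relcomm_cond_real _ sxx (commutantM hx hx).
have [p hp] := quasi_basis_real _ sx hx.
rewrite hf hp (inclZ hi) (incl1 hi) scalerA -rmorphM; congr (_%:C *: _).
pose K := (\sum_(k <- s) cnorm k ^+ 2) * (8 * cnorm x ^+ 2).
pose t0 := (4 * (1 + cnorm x + `|f| + `|f2|))^-1.
have t00 : 0 < t0.
  rewrite invr_gt0 mulr_gt0 //.
  by rewrite -!addrA ltr_wpDr // !addr_ge0 ?cnorm_ge0.
apply: (@first_order _ _ _ f2 _ K t0) => // t tt0.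
have ht (y : R) : 0 <= y -> y <= 1 + cnorm x + `|f| + `|f2| -> `|t| * y <= 4^-1.
  move=> y0 hy; have := ler_pM (normr_ge0 t) y0 tt0 hy.
  by rewrite /t0 invfM -mulrA mulVf ?mulr1 // gt_eqF // -!addrA ltr_wpDr //
    !addr_ge0 ?cnorm_ge0.
have tx : `|t| * cnorm x <= 4^-1.
  by apply: ht; rewrite ?cnorm_ge0 // -!addrA addrCA lerDl !addr_ge0 ?cnorm_ge0.
have tf : `|t * f| <= 4^-1.
  rewrite normrM; apply: ht => //.
  by rewrite addrAC lerDr !addr_ge0 ?cnorm_ge0.
have tf2 : `|t * f2| <= 4^-1.
  by rewrite normrM; apply: ht => //; rewrite lerDr !addr_ge0 ?cnorm_ge0.
have t1 : `|t| <= 1.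
  have := ht 1 ler01; rewrite mulr1 -!addrA lerDl !addr_ge0 ?cnorm_ge0 //.
  by move=> /(_ isT); clear; lra.
pose k := - (t%:C *: x); pose g := 1 - k.
have gE : g = 1 + t%:C *: x by rewrite /g opprK.
have [l [gl lg l2]] : exists l, [/\ g * l = 1, l * g = 1 & cnorm l <= 2].
  by apply: neumann; rewrite cnormN cnormZr; move: tx; clear; lra.
have sg : star g = g by rewrite gE starD star1 starZr sx.
have hg : commutant (range i) g.
  by rewrite gE; apply: commutantD; [exact: commutant1 | exact: commutantZ].
have sl : star l = l.
  have := congr1 star gl; rewrite starM sg star1 => h.
  by rewrite -[star l]mulr1 -gl mulrA h mul1r.
have hl := commutant_inv gl lg hg.
pose c := 1 + 2 * t * f + t ^+ 2 * f2.
have c0 : 0 < c.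
  have : `|t ^+ 2 * f2| <= 4^-1.
    rewrite expr2 -mulrA normrM; apply: le_trans tf2.
    by rewrite ler_piMl.
  move: tf; rewrite /c !ler_norml -mulrA => /andP[+ _] /andP[+ _].
  by clear; lra.
have gg : E (g * g) = c%:C *: 1.
  rewrite gE mulrDl mul1r mulrDr mulr1 -scalerAl -scalerAr.
  rewrite !(condD hi hE) !(condZ hi hE) (cond1 hi hE) hf hf2 !scalerA.
  rewrite -[X in X + _ + _]scale1r -!scalerDl; congr (_ *: _).
  rewrite -(rmorph1 (real_complex R)) -!rmorphM -!rmorphD; congr (_%:C).
  by rewrite /c; ring.
have sll : star (l * l) = l * l by rewrite starM sl.
have [S hS] := quasi_basis_real _ sll (commutantM hl hl).
have hF := twisted_cond_exp hi hE c0 hg sg gg.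
have hFi := twisted_index hi hE c0 hg sg gl lg hs hS.
have rS : r <= c * S by apply: hmin hF _ hFi; exists s.
apply: le_trans rS _; rewrite ler_pM2l // -/c.
have lE : l = 1 + k * l by rewrite -gl mulrBl mul1r subrK.
pose W := x * x * (l + l + l * l).
have llE : l * l = 1 + k + k + (t ^+ 2)%:C *: W.
  have kk : k * k = (t ^+ 2)%:C *: (x * x).
    by rewrite mulrNN -scalerAl -scalerAr scalerA -rmorphM -expr2.
  have e1 : l * l = 1 + k * (l + l * l).
    by rewrite {1}lE mulrDl mul1r {1}lE -addrA -mulrA -mulrDr.
  have e2 : l + l * l = 1 + 1 + k * (l + l + l * l).
    by rewrite {1}lE {1}e1 addrACA -mulrDr addrA.
  rewrite /W scalerAl -kk -mulrA {1}e1 e2 mulrDr [k * (1 + 1)]mulrDr mulr1.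
  by rewrite !addrA.
have : cnorm ((S - r + 2 * t * p)%:C *: (1 : A)) <= t ^+ 2 * K.
  have -> : (S - r + 2 * t * p)%:C *: (1 : A) =
      (t ^+ 2)%:C *: \sum_(k <- s) k * W * star k.
    rewrite rmorphD rmorphB scalerDl scalerBl -hS -hr rmorphM -scalerA -hp.
    rewrite !scaler_sumr -sumrB -big_split /=; apply: eq_bigr => q _.
    rewrite llE !mulrDr !mulrDl mulr1 !mulrN !mulNr -!scalerAr -!scalerAl.
    rewrite mul1r rmorphD scalerDl.
    exact: sub_sub_addK.
  rewrite cnormZr ger0_norm ?sqr_ge0 // ler_wpM2l ?sqr_ge0 //.
  rewrite (le_trans (quasi_basis_bound _ _)) // ler_wpM2l //.
    by rewrite sumr_ge0 // => q _; rewrite exprn_ge0 ?cnorm_ge0.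
  rewrite (le_trans (cnormM _ _)) // mulrC ler_pM ?cnorm_ge0 //.
    have := cnormD (l + l) (l * l); have := cnormD l l; have := cnormM l l.
    have : cnorm l * cnorm l <= 2 * 2 by rewrite ler_pM ?cnorm_ge0.
    by move: l2; clear; lra.
  by rewrite expr2 cnormM.
rewrite cnormZr cnorm1 mulr1 => /(le_trans (ler_norm _)).
by clear; lra.
Qed.



Lemma minimal_quasi_basis {R : realType} {B A : cstarType R} (i : B -> A)
    (E : A -> B) s (r : R) x :
  cstar_inclusion i -> simple_cstar B -> simple_cstar A ->
  minimal_cond_exp i E -> quasi_basis i E s ->
  \sum_(k <- s) k * star k = r%:C *: 1 -> commutant (range i) x ->
  \sum_(k <- s) k * x * star k = r%:C *: i (E x).
Proof.
move=> hi simB simA hmin hs hr hx; have [hE _ _] := hmin.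
have hsx := relcomm_star hi hx.
have h y (sy : star y = y) :=
  minimal_quasi_basis_real hi simB simA hmin hs hr sy.
have hre : \sum_(k <- s) k * cre x * star k = r%:C *: i (E (cre x)).
  by apply: h; [exact: star_cre | apply/commutantZ/commutantD].
have him : \sum_(k <- s) k * cim x * star k = r%:C *: i (E (cim x)).
  by apply: h; [exact: star_cim | apply/commutantZ/commutantZ/commutantB].
rewrite [in RHS](cre_cimE x) (condD hi hE) (condZ hi hE) (inclD hi) (inclZ hi).
rewrite scalerDr scalerA mulrC -scalerA -hre -him scaler_sumr -big_split /=.
apply: eq_bigr => k _; rewrite {1}(cre_cimE x) mulrDr mulrDl -!scalerAr.
by rewrite -!scalerAl.
Qed.

(** * The Jones tower *)

Section JonesTower.
Context {R : realType} (T : tower R) (tau : R).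
Local Notation iA := (@incA R T).
Local Notation iBA := (@incB R T).
Hypothesis hT : is_jones_tower T tau.
Hypotheses (hB : simple_cstar (alg T 0)) (hA : simple_cstar (alg T 1)).

Lemma inc_incl n : cstar_inclusion (inc T n).
Proof. by case: hT. Qed.

Lemma basicE n : basic_construction (inc T n) (E T n) (inc T n.+1) (jones T n).
Proof. by case: hT. Qed.

Lemma dualE n : dual_cond_exp (inc T n.+1) (jones T n) tau (E T n.+1).
Proof. by case: hT. Qed.

Lemma E_cond n : cond_exp (inc T n) (E T n).
Proof. by case: n => [|n]; [case: hT => _ [] | case: (dualE n)]. Qed.

Let incM n := inclM (inc_incl n).
Let inc1 n := incl1 (inc_incl n).
Let incZ n := inclZ (inc_incl n).
Let inc_star n := incl_star (inc_incl n).
Let inc_sum n := incl_sum (inc_incl n).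
Let E_sum n := cond_sum (inc_incl n) (E_cond n).
Let E_star n := cond_star (inc_incl n) (E_cond n).
Let EMl n := condMl (inc_incl n) (E_cond n).

Lemma E_compress n x :
  jones T n * inc T n.+1 x * jones T n = inc T n.+1 (inc T n (E T n x)) * jones T n.
Proof. exact: jones_compress (inc_incl n) (E_cond n) (basicE n) x. Qed.

Lemma jones_inc n x :
  jones T n * inc T n.+1 (inc T n x) = inc T n.+1 (inc T n x) * jones T n.
Proof. exact: jones_comm (inc_incl n) (E_cond n) (basicE n) x. Qed.

Lemma E_pushdownl n m :
  jones T n * inc T n.+1 (E T n.+1 (jones T n * m)) = tau%:C *: (jones T n * m).
Proof.
exact: (pushdownl (inc_incl n) (inc_incl n.+1) (E_cond n) (basicE n) (dualE n)).
Qed.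

Lemma E_inc_jones n x : E T n.+1 (inc T n.+1 x * jones T n) = tau%:C *: x.
Proof.
by have := dual_condE (dualE n) x 1; rewrite inc1 !mulr1.
Qed.

Lemma finite_index : exists2 s, quasi_basis (inc T 0) (E T 0) s &
  \sum_(k <- s) k * star k = tau^-1%:C *: 1.
Proof. by case: hT. Qed.

Lemma jones_quasi_basis s : quasi_basis (inc T 0) (E T 0) s ->
  \sum_(k <- s) inc T 1 k * jones T 0 * inc T 1 (star k) = 1.
Proof.
move=> hs; have [act [_ [actP actM act_inj] actj acte _]] := basicE 0.
apply: act_inj; apply/funext => x.
have act0 : act 0 x = 0.
  by have := actP (- 1) 0 0 x; rewrite scaleN1r oppr0 addr0 scaleN1r addNr.
have actD m m' : act (m + m') x = act m x + act m' x.
  by rewrite -[m]scale1r actP !scale1r.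
have -> : act 1 x = x by rewrite -(inc1 1) actj mul1r.
rewrite (big_morph (act^~ x) actD act0).
have [hx _] := hs x; rewrite [RHS]hx; apply: eq_bigr => k _.
by rewrite !actM !actj acte.
Qed.

Lemma tau_neq0 : tau != 0.
Proof.
have [s hs hr] := finite_index.
have : E T 1 1 = (tau * tau^-1)%:C *: 1.
  rewrite -(jones_quasi_basis hs) E_sum rmorphM -scalerA -hr scaler_sumr.
  by apply: eq_bigr => k _; rewrite (dual_condE (dualE 0)).
rewrite (cond1 (inc_incl 1) (E_cond 1)) -[LHS]scale1r.
rewrite -(rmorph1 (real_complex R)) => /scalar_inj.
by apply: contra_eq_neq => ->; rewrite mul0r oner_eq0.
Qed.

Lemma E_nondegenerate n : nondegenerate (E T n).
Proof.
case: n => [z hz|n].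
  have [s hs _] := finite_index; have [-> _] := hs z.
  by apply: big1 => k _; rewrite hz (incl0 (inc_incl 0)) mulr0.
exact: (nondegenerate_dual (inc_incl n) (inc_incl n.+1) (E_cond n) (basicE n)
  (dualE n) tau_neq0).
Qed.

Lemma star_jones n : star (jones T n) = jones T n.
Proof. exact: jones_star (inc_incl n) (E_cond n) (basicE n) (@E_nondegenerate n). Qed.

Lemma jonesK n : jones T n * jones T n = jones T n.
Proof. exact: jones_idem (inc_incl n) (E_cond n) (basicE n). Qed.

Lemma E_faithful n x : E T n (star x * x) = 0 -> x = 0.
Proof.
exact: (cond_faithful (inc_incl n) (inc_incl n.+1) (E_cond n) (basicE n)
  (star_jones n)).
Qed.

Lemma tau_gt0 : 0 < tau.
Proof.
rewrite lt_neqAle eq_sym tau_neq0 /=.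
have [q] := cond_pos (inc_incl 1) (E_cond 1) (jones T 0).
rewrite star_jones jonesK (dual_cond_jones (inc_incl 1) (dualE 0)).
by move/esym/star_mul_scalar_ge0.
Qed.

Lemma jones_braid n : inc T n.+2 (jones T n) * jones T n.+1 * inc T n.+2 (jones T n)
  = tau%:C *: inc T n.+2 (jones T n).
Proof.
have [act [_ [actP actM act_inj] actj acte _]] := basicE n.+1.
apply: act_inj; apply/funext => x.
by rewrite !actM acte !actj E_pushdownl -incZ actj -scalerAl.
Qed.

Fixpoint iB n : alg T 0 -> alg T n :=
  if n is n'.+1 then fun b => inc T n' (iB n' b) else id.

Lemma incBE n b : iBA n b = inc T n (iB n b).
Proof. by elim: n => // n IHn; rewrite /= -IHn. Qed.

Lemma incAM n x y : iA n (x * y) = iA n x * iA n y.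
Proof. by elim: n => //= n ->; rewrite incM. Qed.

Lemma incA_star n x : iA n (star x) = star (iA n x).
Proof. by elim: n => //= n ->; rewrite inc_star. Qed.

Lemma v_comm n b : v T n * iBA n b = iBA n b * v T n.
Proof.
elim: n => [|n IHn]; first by rewrite mulr1 mul1r.
rewrite /= [iBA n.+1 b]/(inc T n.+1 (iBA n b)) -mulrA -incM IHn incM mulrA.
by rewrite incBE jones_inc mulrA.
Qed.

Lemma star_vS n : star (v T n.+1) = inc T n.+1 (star (v T n)) * jones T n.
Proof. by rewrite /= starM star_jones inc_star. Qed.

Fixpoint e1 n : alg T n.+2 := if n is n'.+1 then inc T n'.+2 (e1 n') else jones T 0.

Lemma v_jones_v n : inc T n.+1 (star (v T n)) * jones T n * inc T n.+1 (v T n) =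
  (tau ^+ n)%:C *: e1 n.
Proof.
elim: n => [|n IHn]; first by rewrite /= star1 inc1 mulr1 mul1r scale1r.
rewrite star_vS /= !incM -!mulrA [jones _ _ * (_ * _)]mulrA [inc _ _ _ * (_ * _ * _)]mulrA.
rewrite [inc _ _ (jones _ _) * _]mulrA jones_braid -scalerAl -scalerAr mulrA.
by rewrite -!incM IHn incZ scalerA exprS rmorphM.
Qed.

Lemma e1_quasi_basis n s : quasi_basis (inc T 0) (E T 0) s ->
  \sum_(k <- s) iA n.+1 k * e1 n * iA n.+1 (star k) = 1.
Proof.
move=> hs; elim: n => [|n IHn]; first exact: jones_quasi_basis.
rewrite -(inc1 n.+2) -IHn inc_sum; apply: eq_bigr => k _.
by rewrite !incM.
Qed.

Lemma E_v_conj n a : E T n (v T n * iA n a * star (v T n)) =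
  (tau ^+ n)%:C *: iB n (E T 0 a).
Proof.
elim: n => [|n IHn]; first by rewrite /= star1 mulr1 mul1r scale1r.
have -> : v T n.+1 * iA n.+1 a * star (v T n.+1) =
    jones T n * inc T n.+1 (v T n * iA n a * star (v T n)) * jones T n.
  by rewrite star_vS /= !incM !mulrA.
by rewrite E_compress E_inc_jones IHn incZ scalerA -rmorphM -exprS.
Qed.

(* On [A_n], seen as the tensor product over [B] of [n + 1] copies of [A],
   [Lop a] and [Qop a] insert a factor [a] on the left and on the right, while
   [Rop a] and [Rtop a] contract [a] with the last and with the first factor
   [y], which leaves [E_0 (y * a)] and [E_0 (a * y)]. *)
Definition Rop n (a : alg T 1) (x : alg T n.+1) : alg T n :=
  (tau^-1 ^+ n)%:C *: E T n (x * iA n a * star (v T n)).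

Definition Rtop n (a : alg T 1) (x : alg T n.+1) : alg T n :=
  (tau^-1 ^+ n)%:C *: E T n (v T n * iA n a * x).

Definition Lop n (a : alg T 1) (u : alg T n) : alg T n.+1 :=
  iA n a * star (v T n) * inc T n u.

Definition Qop n (a : alg T 1) (u : alg T n) : alg T n.+1 :=
  inc T n u * v T n * iA n a.

Lemma tauVX n : (tau^-1 ^+ n)%:C * (tau ^+ n)%:C = 1 :> R[i].
Proof. by rewrite -rmorphM -exprMn mulVf ?tau_neq0 // expr1n. Qed.

Lemma tauVXS n : (tau^-1 ^+ n.+1)%:C * tau%:C = (tau^-1 ^+ n)%:C :> R[i].
Proof. by rewrite -rmorphM exprSr mulfVK ?tau_neq0. Qed.

Lemma Rop_Lop n a b u : @Rop n.+1 a (@Lop n.+1 b u) = Lop b (Rop a u).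
Proof.
rewrite /Rop /Lop.
have -> : iA n.+1 b * star (v T n.+1) * inc T n.+1 u * iA n.+1 a * star (v T n.+1)
  = inc T n.+1 (iA n b * star (v T n)) *
    (jones T n * inc T n.+1 (u * iA n a * star (v T n)) * jones T n).
  by rewrite star_vS !incM !mulrA.
rewrite E_compress mulrA -incM E_inc_jones scalerA tauVXS incZ.
by rewrite -scalerAr.
Qed.

Lemma Qop_Lop n a b u : @Qop n.+1 b (@Lop n a u) = @Lop n.+1 a (@Qop n b u).
Proof.
rewrite /Qop /Lop star_vS /= !incM !mulrA; congr (_ * _ * _).
by rewrite -!mulrA; congr (_ * (_ * _)); rewrite jones_inc.
Qed.

Lemma Rop_Qop n a b u : @Rop n a (Qop b u) = u * iB n (E T 0 (b * a)).
Proof.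
rewrite /Rop /Qop -[_ * iA n a]mulrA -incAM -!mulrA EMl !mulrA E_v_conj.
by rewrite -scalerAr scalerA tauVX scale1r.
Qed.

Section QuasiBasis.
Variable s : seq (alg T 1).
Hypothesis hs : quasi_basis (inc T 0) (E T 0) s.

Lemma sum_Lop_Rtop n (x : alg T n.+1) :
  \sum_(k <- s) Lop k (Rtop (star k) x) = x.
Proof.
case: n x => [|n] x.
  have [h _] := hs x; rewrite [RHS]h; apply: eq_bigr => k _.
  by rewrite /Lop /Rtop /= star1 mulr1 mul1r scale1r.
have h k : Lop k (Rtop (star k) x) =
    iA n.+1 k * e1 n * iA n.+1 (star k) * x.
  rewrite /Lop /Rtop star_vS incZ -scalerAr.
  have -> : v T n.+1 * iA n.+1 (star k) * x =
      jones T n * (inc T n.+1 (v T n * iA n (star k)) * x).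
    by rewrite /= incM !mulrA.
  rewrite -!mulrA E_pushdownl.
  have -> : iA n.+1 k * (inc T n.+1 (star (v T n)) * (tau%:C *: (jones T n *
      (inc T n.+1 (v T n * iA n (star k)) * x)))) =
    tau%:C *: (iA n.+1 k * (inc T n.+1 (star (v T n)) * jones T n *
      inc T n.+1 (v T n)) * iA n.+1 (star k) * x).
    by rewrite -!scalerAr /= incM !mulrA.
  rewrite v_jones_v -scalerAr -!scalerAl !scalerA tauVXS tauVX scale1r.
  by rewrite !mulrA.
rewrite (eq_bigr _ (fun k _ => h k)) -mulr_suml e1_quasi_basis //.
by rewrite mul1r.
Qed.

Lemma star_Lop n a u : star (@Lop n a u) = Qop (star a) (star u).
Proof. by rewrite /Lop /Qop !starM starK inc_star incA_star mulrA. Qed.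

Lemma star_Qop n a u : star (@Qop n a u) = Lop (star a) (star u).
Proof. by rewrite -[RHS]starK star_Lop !starK. Qed.

Lemma star_Rtop n a x : star (@Rtop n a x) = Rop (star a) (star x).
Proof. by rewrite /Rop /Rtop starZr -E_star !starM incA_star mulrA. Qed.

Lemma sum_Qop_Rop n (x : alg T n.+1) :
  \sum_(k <- s) Qop (star k) (Rop k x) = x.
Proof.
rewrite -[RHS]starK -[X in star X]sum_Lop_Rtop raddf_sum /=.
by apply: eq_bigr => k _; rewrite star_Lop star_Rtop !starK.
Qed.

End QuasiBasis.

End JonesTower.

(** * Expectations commuting with the relative commutant *)

Section CentralExpectation.
Context {R : realType} {B A : cstarType R} (i : B -> A) (E : A -> B).
Hypotheses (hi : cstar_inclusion i) (hE : cond_exp i E) (simB : simple_cstar B).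
Hypothesis E_faithful : forall x, E (star x * x) = 0 -> x = 0.
Variables (I : Type) (s : seq I) (w : I -> A) (kap r : R[i]).
Hypothesis hs : forall x,
  x = kap *: \sum_(k <- s) w k * i (E (star (w k) * x)).
Hypothesis hs' : forall x,
  x = kap *: \sum_(k <- s) i (E (x * w k)) * star (w k).
Let relcomm := commutant (range i).
Hypothesis r0 : r != 0.
Hypothesis hr : forall x, relcomm x ->
  kap *: \sum_(k <- s) w k * x * star (w k) = r *: i (E x).

(* The modular automorphism of [E] on the relative commutant. *)
Let theta x := kap *: \sum_(k <- s) i (E (w k * x)) * star (w k).

Let thetaE x a : relcomm x -> E (a * x) = E (theta x * a).
Proof.
move=> /commutant_rangeE hx.
rewrite [in LHS](hs a) /theta -!scalerAl !mulr_suml.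
rewrite !(condZ hi hE) !(cond_sum hi hE); congr (_ *: _).
apply: eq_bigr => k _; rewrite -[_ * star (w k) * a]mulrA (condMl hi hE).
by rewrite -mulrA -hx mulrA (condMr hi hE).
Qed.

Let E_faithfulr x : E (x * star x) = 0 -> x = 0.
Proof.
move=> h; rewrite -[x]starK [star x]E_faithful ?star0 //.
by rewrite starK.
Qed.

Let theta_relcomm x : relcomm x -> relcomm (theta x).
Proof.
move=> hx; apply/commutant_rangeE => b; apply/eqP; rewrite -subr_eq0.
apply/eqP; apply: E_faithfulr; set z := star _.
rewrite mulrBl (condB hi hE) -mulrA -thetaE // -!mulrA !(condMl hi hE).
by rewrite -thetaE // subrr.
Qed.

Let E_theta x y : relcomm x -> relcomm y -> E (x * theta y) = E (y * x).
Proof.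
move=> hx hy; apply: (incl_inj hi).
have hx' := (commutant_rangeE _ _).1 hx.
apply: (scalerI r0); rewrite -!hr; try exact: commutantM; last first.
  by apply: commutantM => //; apply: theta_relcomm.
congr (_ *: _).
transitivity (\sum_(k <- s) \sum_(l <- s)
    kap *: (w k * i (E (star (w k) * (w l * y))) * x * star (w l))).
  apply: eq_bigr => k _; rewrite mulrA -mulrA [theta y * _]hs'.
  rewrite -scalerAr mulr_sumr scaler_sumr; apply: eq_bigr => l _.
  rewrite -[theta y * _ * _]mulrA -thetaE // -[star (w k) * w l * y]mulrA.
  by congr (_ *: _); rewrite -!mulrA; congr (_ * _); rewrite !mulrA hx'.
rewrite exchange_big /=; apply: eq_bigr => l _.
rewrite -scaler_sumr -!mulr_suml !scalerAl -hs.
by rewrite !mulrA.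
Qed.

Let theta_theta y : relcomm y -> theta (theta y) = y.
Proof.
move=> hy; have h1 := theta_relcomm hy; have h2 := theta_relcomm h1.
apply/eqP; rewrite -subr_eq0; apply/eqP; apply: E_faithfulr.
have hd : relcomm (star (theta (theta y) - y)).
  by apply: relcomm_star => //; apply: commutantB.
by rewrite mulrBl (condB hi hE) -thetaE // E_theta // subrr.
Qed.

Let E_pos x : relcomm x -> exists2 c : R, 0 <= c & E (star x * x) = c%:C *: 1.
Proof.
move=> hx; have hxx := commutantM (relcomm_star hi hx) hx.
have [c hc] := cond_relcomm_scalar hi simB hE hxx.
have sE : star (E (star x * x)) = E (star x * x).
  by rewrite -(cond_star hi hE) starM starK.
have [d hd] := scalar_real sE hc; exists d => //.
have [q hq] := cond_pos hi hE x.
by apply: (@star_mul_scalar_ge0 _ _ q); rewrite -hq.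
Qed.

(* [theta] is a positive involution, hence the identity. *)
Lemma cond_relcommC x a : relcomm x -> E (a * x) = E (x * a).
Proof.
move=> hx; have ht := theta_relcomm hx.
suff th : theta x = x by rewrite thetaE // th.
pose y := x - theta x; have hy : relcomm y by apply: commutantB.
have ty : theta y = - y.
  rewrite opprB -{2}(theta_theta hx) /theta /y -scalerBr -sumrB.
  congr (_ *: _); apply: eq_bigr => k _.
  by rewrite -mulrBl -(inclB hi) -(condB hi hE) -mulrBr.
have [c c0 hc] := E_pos hy; have [d d0 hd] := E_pos (relcomm_star hi hy).
have : E (star y * y) = - E (star (star y) * star y).
  by rewrite thetaE // ty starK mulNr (condN hi hE).
rewrite hc hd -scaleNr -rmorphN => /scalar_inj cd.
have c00 : c = 0 by apply/eqP; rewrite eq_le c0 cd oppr_le0 d0.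
have := hc; rewrite c00 scale0r => /E_faithful/eqP.
by rewrite subr_eq0 => /eqP.
Qed.
End CentralExpectation.

(** * Words *)

Section WordExpansions.
Context {R : realType} (T : tower R) (tau : R).
Local Notation iA := (@incA R T).
Local Notation iBA := (@incB R T).
Hypothesis hT : is_jones_tower T tau.
Hypotheses (hB : simple_cstar (alg T 0)) (hA : simple_cstar (alg T 1)).

Lemma incA_incl n : cstar_inclusion (@incA R T n).
Proof.
elim: n => [|n IHn] /=; first exact: incl_id.
have hi := inc_incl hT n.+1.
split=> [a x y||b|x y].
- by rewrite (inclP IHn) (inclP hi).
- by split=> [|x y]; rewrite ?(incl1 IHn) ?(incl1 hi) // (inclM IHn) (inclM hi).
- by rewrite (incl_star IHn) (incl_star hi).
- by move/(incl_inj hi)/(incl_inj IHn).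
Qed.

Lemma incB_incl n : cstar_inclusion (@incB R T n).
Proof.
have hi := inc_incl hT 0; have hj := incA_incl n.
split=> [a x y||b|x y]; rewrite /incB.
- by rewrite (inclP hi) (inclP hj).
- by split=> [|x y]; rewrite ?(incl1 hi) ?(incl1 hj) // (inclM hi) (inclM hj).
- by rewrite (incl_star hi) (incl_star hj).
- by move/(incl_inj hj)/(incl_inj hi).
Qed.

Lemma Etr_cond n : cond_exp (@incB R T n) (@Etr R T n).
Proof.
elim: n => [|n IHn]; first exact: E_cond hT 0.
have hi := inc_incl hT n.+1; have hE := E_cond hT n.+1; have hB' := incB_incl n.
have hB'' := incB_incl n.+1.
split=> /= [x _|a x y _ _|x _|_ [b _ <-]|_ x [b _ <-] _].
- by eexists.
- by rewrite (condP hi hE) (condP hB' IHn) (inclP hB'').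
- have [q hq] := cond_pos hi hE x; have [p hp] := cond_pos hB' IHn q.
  exists (iBA n.+1 p); first by exists p.
  by rewrite hq hp (inclM hB'') (incl_star hB'').
- by rewrite [iBA n.+1 b]/(inc T n.+1 (iBA n b)) (condK hi hE) (condK hB' IHn).
- rewrite [iBA n.+1 b]/(inc T n.+1 (iBA n b)); split.
    by rewrite (condMl hi hE) (condMl hB' IHn) (inclM hB'').
  by rewrite (condMr hi hE) (condMr hB' IHn) (inclM hB'').
Qed.

Lemma Etr_faithful n (x : alg T n.+1) : Etr (star x * x) = 0 -> x = 0.
Proof.
elim: n x => [|n IHn] x /=; first exact: (@E_faithful _ _ _ hT 0).
have [q hq] := cond_pos (inc_incl hT n.+1) (E_cond hT n.+1) x.
rewrite hq => /IHn q0; apply: (@E_faithful _ _ _ hT n.+1).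
by rewrite hq q0 mulr0.
Qed.

Section Words.
Variable s : seq (alg T 1).
Hypothesis hs : quasi_basis (inc T 0) (E T 0) s.

Lemma LopD n a (x y : alg T n) : Lop a (x + y) = Lop a x + Lop a y.
Proof. by rewrite /Lop (inclD (inc_incl hT n)) mulrDr. Qed.

Lemma Lop0 n a : @Lop R T n a 0 = 0.
Proof. by rewrite /Lop (incl0 (inc_incl hT n)) mulr0. Qed.

Lemma Lop_sum n a I (r : seq I) (F : I -> alg T n) :
  Lop a (\sum_(k <- r) F k) = \sum_(k <- r) Lop a (F k).
Proof. exact: (big_morph (@Lop R T n a) (LopD a) (Lop0 n a)). Qed.

Lemma RopD n a (x y : alg T n.+1) : Rop tau a (x + y) = Rop tau a x + Rop tau a y.
Proof.
by rewrite /Rop !mulrDl (condD (inc_incl hT n) (E_cond hT n)) scalerDr.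
Qed.

Lemma Rop0 n a : @Rop R T tau n a 0 = 0.
Proof.
by rewrite /Rop !mul0r (cond0 (inc_incl hT n) (E_cond hT n)) scaler0.
Qed.

(* Junk value [0] if [m] and [n] differ. *)
Definition cast_alg m n (u : alg T m) : alg T n :=
  if m =P n is ReflectT e then eq_rect m (alg T) u n e else 0.

Lemma cast_algE m (u : alg T m) : cast_alg m u = u.
Proof. by rewrite /cast_alg; case: eqP => // e; rewrite eq_axiomK. Qed.

(* [u] with the factors [c] inserted on the left; it is [0] unless
   [n = size c + m]. *)
Fixpoint Lword (c : seq (alg T 1)) m n : alg T m -> alg T n :=
  match c with
  | [::] => @cast_alg m n
  | a :: c' => if n is n'.+1 then fun u => Lop a (Lword c' n' u) else fun=> 0
  end.

Lemma Rop_Lword a c m n (u : alg T m.+1) :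
  Rop tau a (Lword c n.+1 u) = Lword c n (Rop tau a u).
Proof.
elim: c n => [|b c IHc] n /=.
  have [mn|mn] := eqVneq m n.
    by move: u; rewrite mn => u; rewrite !cast_algE.
  rewrite /cast_alg; case: eqP => [e|_].
    by case/eqP: mn; case: e.
  by rewrite Rop0; case: eqP => // e; case/eqP: mn.
case: n => [|n] /=; last by rewrite (Rop_Lop hT) IHc.
have -> : Lword c 0 u = 0 by case: c {IHc} => //=; rewrite /cast_alg; case: eqP.
by rewrite Lop0 Rop0.
Qed.

Definition tensor_shift n (x : alg T n.+1) : alg T n.+1 :=
  \sum_(k <- s) Lop k (Rop tau (star k) x).

Lemma tensor_shift_Lword c m n (u : alg T m.+1) : tensor_shift (Lword c n.+1 u) =
  \sum_(k <- s) Lword (k :: c) n.+1 (Rop tau (star k) u).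
Proof. by apply: eq_bigr => k _; rewrite Rop_Lword. Qed.

Lemma iter_tensor_shift_sum j n I (r : seq I) (F : I -> alg T n.+1) :
  iter j (@tensor_shift n) (\sum_(k <- r) F k) = \sum_(k <- r) iter j (@tensor_shift n) (F k).
Proof.
have shiftD x y : tensor_shift (x + y) = @tensor_shift n x + tensor_shift y.
  rewrite /tensor_shift -big_split; apply: eq_bigr => k _.
  by rewrite RopD LopD.
have shift0 : @tensor_shift n 0 = 0.
  by apply: big1 => k _; rewrite Rop0 Lop0.
elim: j => //= j ->; exact: (big_morph (@tensor_shift n) shiftD shift0).
Qed.

Fixpoint words m : seq (seq (alg T 1)) :=
  if m is m'.+1 then [seq l :: t | l <- s, t <- words m'] else [:: [::]].

Lemma size_words m t : t \in words m -> size t = m.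
Proof.
by elim: m t => [|m IHm] t /=; [rewrite inE => /eqP-> |
  case/allpairsP => -[l t'] /= [_ /IHm <- ->]].
Qed.

Lemma words_cons (V : zmodType) m (F : seq (alg T 1) -> V) :
  \sum_(t <- words m.+1) F t = \sum_(k <- s) \sum_(t <- words m) F (k :: t).
Proof. by rewrite big_allpairs_dep. Qed.

Lemma words_rcons (V : zmodType) m (F : seq (alg T 1) -> V) :
  \sum_(t <- words m.+1) F t = \sum_(t <- words m) \sum_(k <- s) F (rcons t k).
Proof.
elim: m F => [|m IHm] F.
  by rewrite words_cons !big_seq1; apply: eq_bigr => k _; rewrite big_seq1.
rewrite !words_cons.
by apply: eq_bigr => l _; rewrite IHm.
Qed.

Lemma words_rev (V : zmodType) m (F : seq (alg T 1) -> V) :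
  \sum_(t <- words m) F (rev t) = \sum_(t <- words m) F t.
Proof.
elim: m F => [|m IHm] F; first by rewrite !big_seq1.
rewrite [RHS]words_rcons [RHS]exchange_big words_cons; apply: eq_bigr => l _.
rewrite -(IHm (fun t => F (rcons t l))).
by apply: eq_bigr => t _; rewrite rev_cons.
Qed.

Fixpoint Rword m (t : seq (alg T 1)) : alg T m -> alg T 0 :=
  if m is m'.+1 then fun u => Rword (behead t) (Rop tau (star (head 0 t)) u) else id.

Fixpoint Rtword m (t : seq (alg T 1)) : alg T m -> alg T 0 :=
  if m is m'.+1 then fun u => Rtword (behead t) (Rtop tau (star (head 0 t)) u) else id.

Lemma iter_tensor_shift m n c (u : alg T m) : iter m (@tensor_shift n) (Lword c n.+1 u) =
  \sum_(t <- words m) Lword (rev t ++ c) n.+1 (Rword t u).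
Proof.
elim: m c u => [|m IHm] c u; first by rewrite big_seq1.
rewrite iterSr tensor_shift_Lword iter_tensor_shift_sum words_cons.
apply: eq_bigr => k _; rewrite IHm; apply: eq_bigr => t _.
by rewrite rev_cons cat_rcons.
Qed.

Lemma iter_tensor_shift_full n (x : alg T n.+1) : iter n.+1 (@tensor_shift n) x =
  \sum_(t <- words n.+1) Lword t n.+1 (Rword (rev t) x).
Proof.
rewrite -{1}(cast_algE x) -[cast_alg _ _]/(Lword [::] n.+1 x) iter_tensor_shift.
rewrite -words_rev; apply: eq_bigr => t _.
by rewrite cats0 revK.
Qed.

Lemma sum_words m (x : alg T m) :
  x = \sum_(t <- words m) Lword t m (Rtword t x).
Proof.
elim: m x => [|m IHm] x; first by rewrite big_seq1 /= cast_algE.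
rewrite -{1}(sum_Lop_Rtop hT hs x) words_cons; apply: eq_bigr => k _.
by rewrite {1}(IHm (Rtop tau (star k) x)) Lop_sum.
Qed.

Lemma Qop_Lword n a c : size c = n -> Qop a (Lword c n (1 : alg T 0)) =
  Lword (rcons c a) n.+1 (1 : alg T 0).
Proof.
elim: n c => [|n IHn] [|b c] //= => [_|[hc]].
  by rewrite !cast_algE /Qop /Lop /= (incl1 (inc_incl hT 0)) star1 !mulr1 !mul1r.
by rewrite (Qop_Lop hT) IHn.
Qed.

Lemma star_Lword n c : size c = n -> star (Lword c n (1 : alg T 0)) =
  Lword (rev (map star c)) n (1 : alg T 0).
Proof.
elim: n c => [|n IHn] [|b c] //= => [_|[hc]]; first by rewrite cast_algE star1.
by rewrite (star_Lop hT) IHn // rev_cons Qop_Lword // size_rev size_map.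
Qed.

Lemma Lword_iB n c b : size c = n ->
  Lword c n b = Lword c n (1 : alg T 0) * iB n b.
Proof.
elim: n c => [|n IHn] [|a c] //= => [_|[hc]]; first by rewrite !cast_algE mul1r.
by rewrite IHn // /Lop (inclM (inc_incl hT n)) !mulrA.
Qed.

Fixpoint kappa n : R[i] :=
  if n is n'.+1 then (tau^-1 ^+ n)%:C * kappa n' else 1.

Lemma Rword_Etr n t (x : alg T n.+1) : size t = n.+1 ->
  Rword t x = kappa n *: Etr (x * Lword (map star t) n.+1 (1 : alg T 0)).
Proof.
elim: n t x => [|n IHn] [|l t] x //= [ht].
  case: t ht => // _; rewrite /= /Rop /Lop cast_algE expr0 !scale1r /=.
  by rewrite !star1 !mulr1 (incl1 (inc_incl hT 0)) mulr1.
rewrite [LHS]IHn // /Rop -scalerAl (condZ (incB_incl n) (Etr_cond n)).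
rewrite scalerA mulrC; congr (_ *: Etr _).
by rewrite -(condMr (inc_incl hT n.+1) (E_cond hT n.+1)) /Lop !mulrA.
Qed.

Lemma Rtword_Etr n t (x : alg T n.+1) : size t = n.+1 ->
  Rtword t x = kappa n *: Etr (star (Lword t n.+1 (1 : alg T 0)) * x).
Proof.
elim: n t x => [|n IHn] [|l t] x //= [ht].
  case: t ht => // _; rewrite /= /Rtop /Lop cast_algE expr0 !scale1r /=.
  by rewrite !star1 !mulr1 mul1r (incl1 (inc_incl hT 0)) mulr1.
rewrite [LHS]IHn // /Rtop -scalerAr (condZ (incB_incl n) (Etr_cond n)).
rewrite scalerA mulrC; congr (_ *: Etr _).
rewrite -(condMl (inc_incl hT n.+1) (E_cond hT n.+1)) (star_Lop hT) /Qop.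
by rewrite !mulrA.
Qed.

Lemma words_quasi_basis n (x : alg T n.+1) : x = kappa n *: \sum_(t <- words n.+1)
  Lword t n.+1 (1 : alg T 0) * iBA n (Etr (star (Lword t n.+1 (1 : alg T 0)) * x)).
Proof.
rewrite {1}(sum_words x) scaler_sumr; apply: eq_big_seq => t /size_words ht.
rewrite Lword_iB // Rtword_Etr // scalerAr.
by rewrite -(inclZ (incB_incl n)) incBE.
Qed.

End Words.

End WordExpansions.

(** * The rotation *)

Section Rotation.
Context {R : realType} (T : tower R) (tau : R).
Local Notation iA := (@incA R T).
Local Notation iBA := (@incB R T).
Hypothesis hT : is_jones_tower T tau.
Hypotheses (hB : simple_cstar (alg T 0)) (hA : simple_cstar (alg T 1)).


Variable s : seq (alg T 1).
Hypothesis hs : quasi_basis (inc T 0) (E T 0) s.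
Hypothesis hr : \sum_(k <- s) k * star k = tau^-1%:C *: 1.

Let incM n := inclM (inc_incl hT n).
Let inc1 n := incl1 (inc_incl hT n).
Let incZ n := inclZ (inc_incl hT n).
Let inc_star n := incl_star (inc_incl hT n).
Let EZ n := condZ (inc_incl hT n) (E_cond hT n).
Let E_sum n := cond_sum (inc_incl hT n) (E_cond hT n).
Let EMl n := condMl (inc_incl hT n) (E_cond hT n).
Let EMr n := condMr (inc_incl hT n) (E_cond hT n).

Lemma E_commutant n (y : alg T n.+2) :
  (forall a, inc T n.+1 a * y = y * inc T n.+1 a) ->
  central (E T n.+1 y).
Proof. by move=> hy a; rewrite -EMl hy EMr. Qed.

Lemma unit_decomposition n : \sum_(k <- s) (tau^-1 ^+ n)%:C *:
  (inc T n.+1 (iA n k * star (v T n)) * jones T n *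
   inc T n.+1 (v T n * iA n (star k))) = 1.
Proof.
rewrite -[RHS](e1_quasi_basis hT n hs); apply: eq_bigr => k _.
have -> : inc T n.+1 (iA n k * star (v T n)) * jones T n *
    inc T n.+1 (v T n * iA n (star k)) = iA n.+1 k *
   (inc T n.+1 (star (v T n)) * jones T n * inc T n.+1 (v T n)) * iA n.+1 (star k).
  by rewrite !incM !mulrA.
rewrite (v_jones_v hT) -scalerAr -scalerAl scalerA (tauVX hT).
by rewrite scale1r.
Qed.

Lemma v_conj_sum n (y : alg T n.+2) :
  (forall a, inc T n.+1 a * y = y * inc T n.+1 a) ->
  jones T n * y * jones T n = inc T n.+1 (E T n.+1 y) * jones T n ->
  \sum_(k <- s) iA n.+1 k * star (v T n.+1) * y * (v T n.+1 * iA n.+1 (star k)) =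
  (tau ^+ n)%:C *: inc T n.+1 (E T n.+1 y).
Proof.
move=> hy ye; have cE := E_commutant hy.
have h k : iA n.+1 k * star (v T n.+1) * y * (v T n.+1 * iA n.+1 (star k)) =
    ((tau ^+ n)%:C *: inc T n.+1 (E T n.+1 y)) *
    (iA n.+1 k * e1 T n * iA n.+1 (star k)).
  have -> : iA n.+1 k * star (v T n.+1) * y * (v T n.+1 * iA n.+1 (star k)) =
      inc T n.+1 (iA n k * star (v T n)) * (jones T n * y * jones T n) *
      inc T n.+1 (v T n) * iA n.+1 (star k).
    by rewrite (star_vS hT) /= !incM !mulrA.
  have -> : (tau ^+ n)%:C *: inc T n.+1 (E T n.+1 y) *
      (iA n.+1 k * e1 T n * iA n.+1 (star k)) = inc T n.+1 (E T n.+1 y) *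
      (iA n.+1 k * ((tau ^+ n)%:C *: e1 T n) * iA n.+1 (star k)).
    by rewrite -!scalerAr -!scalerAl -!scalerAr.
  by rewrite ye mulrA -incM cE incM -(v_jones_v hT) !incM !mulrA.
rewrite (eq_bigr _ (fun k _ => h k)) -mulr_sumr (e1_quasi_basis hT) //.
by rewrite mulr1.
Qed.

Lemma E_jones_commutant n (y : alg T n.+2) x :
  (forall a, inc T n.+1 a * y = y * inc T n.+1 a) ->
  y * jones T n = inc T n.+1 x * jones T n ->
  E T n.+1 y = (tau^-1 ^+ n * tau)%:C *:
    \sum_(k <- s) iA n k * star (v T n) * x * (v T n * iA n (star k)).
Proof.
move=> hy yx; rewrite -[y in LHS]mulr1 -(unit_decomposition n) mulr_sumr E_sum.
rewrite scaler_sumr; apply: eq_bigr => k _.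
rewrite -scalerAr EZ !mulrA -hy -[_ * y * jones T n]mulrA yx mulrA -incM.
by rewrite (dual_condE (dualE hT n)) scalerA -rmorphM !mulrA.
Qed.

Lemma E_corner n (y : alg T n.+2) :
  (forall a, inc T n.+1 a * y = y * inc T n.+1 a) ->
  jones T n * y * jones T n = inc T n.+1 (E T n.+1 y) * jones T n.
Proof.
elim: n y => [|n IHn] y hy.
  have [x hx yx] := jones_commutantr (basicE hT 0) hy.
  suff -> : E T 1 y = inc T 0 (E T 0 x).
    by rewrite -mulrA yx mulrA (E_compress hT).
  rewrite (E_jones_commutant hy yx) /= star1 expr0 mul1r.
  have hx' : commutant (range (inc T 0)) x.
    by apply/commutant_rangeE => b; rewrite hx.
  have hmin : minimal_cond_exp (inc T 0) (E T 0) by case: hT.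
  have := minimal_quasi_basis (inc_incl hT 0) hB hA hmin hs hr hx'.
  under [\sum_(_ <- _) _ * 1 * _ * _]eq_bigr => k _ do rewrite mulr1 mul1r.
  by move=> ->; rewrite scalerA -rmorphM divff ?(tau_neq0 hT) // scale1r.
have [x hx yx] := jones_commutantr (basicE hT n.+1) hy.
rewrite -mulrA yx mulrA (E_compress hT); congr (inc T n.+2 _ * _).
rewrite (E_jones_commutant hy yx) (v_conj_sum hx (IHn _ hx)) scalerA.
by rewrite rmorphM (tauVXS hT) (tauVX hT) scale1r.
Qed.

Local Notation word n t := (@Lword R T t 0 n (1 : alg T 0)).

Lemma conj_kappa n : (kappa tau n)^* = kappa tau n.
Proof.
elim: n => [|n IHn]; first by rewrite /= rmorph1.
transitivity (((tau^-1 ^+ n.+1)%:C : R[i])^* * (kappa tau n)^*).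
  exact: rmorphM.
by rewrite IHn conjC_real.
Qed.

Lemma words_quasi_basis_star n (x : alg T n.+1) :
  x = kappa tau n *: \sum_(t <- words s n.+1)
    iBA n (Etr (x * word n.+1 t)) * star (word n.+1 t).
Proof.
rewrite -{1}[x]starK [star x](words_quasi_basis hT hs) starZ conj_kappa.
rewrite raddf_sum /=; congr (_ *: _); apply: eq_bigr => t _.
rewrite starM -(incl_star (incB_incl hT n)).
by rewrite -(cond_star (incB_incl hT n) (Etr_cond hT n)) starM !starK.
Qed.

Lemma relB_inc n x : relB T n x -> relB T n.+1 (inc T n.+1 x).
Proof.
move/commutant_rangeE => hx; apply/commutant_rangeE => b.
by rewrite [incB n.+1 b]/(inc T n.+1 (iBA n b)) -!incM hx.
Qed.

Lemma relB_E n x : relB T n.+1 x -> relB T n (E T n.+1 x).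
Proof.
move/commutant_rangeE => hx; apply/commutant_rangeE => b.
by rewrite -EMr -EMl -[inc T n.+1 _]/(iBA n.+1 b) hx.
Qed.

Lemma sum_words_conj n x : relB T n x ->
  kappa tau n *: \sum_(t <- words s n.+1) word n.+1 t * x * star (word n.+1 t) =
  (tau^-1 ^+ n.+1)%:C *: iBA n (Etr x).
Proof.
elim: n x => [|n IHn] x hx.
  rewrite words_cons scale1r expr1.
  have hmin : minimal_cond_exp (inc T 0) (E T 0) by case: hT.
  rewrite -[RHS](minimal_quasi_basis (inc_incl hT 0) hB hA hmin hs hr hx).
  apply: eq_bigr => k _; rewrite big_seq1 /= cast_algE /Lop /= star1 inc1.
  by rewrite !mulr1.
pose Y := kappa tau n *: \sum_(t <- words s n.+1)
  inc T n.+1 (word n.+1 t) * x * inc T n.+1 (star (word n.+1 t)).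
have cY a : inc T n.+1 a * Y = Y * inc T n.+1 a.
  rewrite /Y -scalerAr -scalerAl; congr (_ *: _); move: a.
  apply: (weighted_central (inc_incl hT n.+1) (@words_quasi_basis _ _ _ hT _ hs n)
    (@words_quasi_basis_star n)).
  by move=> b; apply: (commutant_rangeE _ _).1 hx b.
have EY : E T n.+1 Y = (tau^-1 ^+ n.+1)%:C *: iBA n (Etr (E T n.+1 x)).
  rewrite -IHn; last exact: relB_E.
  by rewrite EZ E_sum; congr (_ *: _); apply: eq_bigr => t _; rewrite EMr EMl.
transitivity ((tau^-1 ^+ n.+1)%:C *: \sum_(k <- s)
    iA n.+1 k * star (v T n.+1) * Y * (v T n.+1 * iA n.+1 (star k))).
  rewrite words_cons [kappa _ _]/= -scalerA; congr (_ *: _); rewrite scaler_sumr.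
  apply: eq_bigr => k _; rewrite /Y -scalerAr -scalerAl; congr (_ *: _).
  rewrite mulr_sumr mulr_suml; apply: eq_bigr => t _.
  by rewrite (star_Lop hT) /Lop /Qop inc_star !mulrA.
rewrite (v_conj_sum cY (E_corner cY)) EY incZ !scalerA; congr (_ *: _).
rewrite [tau^-1 ^+ n.+2]exprS [RHS]rmorphM; congr (_ * _); rewrite -rmorphM.
by rewrite exprS -mulrA -exprMn mulVf ?(tau_neq0 hT) // expr1n mulr1.
Qed.

Lemma Etr_relBC n x a : relB T n x -> Etr (a * x) = Etr (x * a).
Proof.
apply: (@cond_relcommC _ _ _ _ _ (incB_incl hT n) (Etr_cond hT n) hB
  (@Etr_faithful _ _ _ hT n) _ _ _ _ _ (@words_quasi_basis _ _ _ hT _ hs n)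
    (@words_quasi_basis_star n) _ (@sum_words_conj n)).
by rewrite (inj_eq (@complexI R)) expf_neq0 // invr_eq0 (tau_neq0 hT).
Qed.

Lemma iter_tensor_shift_id n x : relB T n x -> iter n.+1 (@tensor_shift R T tau s n) x = x.
Proof.
move=> hx; rewrite (iter_tensor_shift_full hT) [RHS](sum_words hT hs).
apply: eq_big_seq => t /size_words ht; congr Lword.
rewrite (Rword_Etr hT) ?size_rev // (Rtword_Etr hT) // (star_Lword hT) //.
by congr (_ *: _); rewrite map_rev; apply/esym/Etr_relBC.
Qed.

Definition average n (x : alg T n.+1) : alg T n.+1 :=
  tau%:C *: \sum_(k <- s) iA n k * x * iA n (star k).

Lemma relA_relB n x : relA T n x -> relB T n x.
Proof. by move=> hx _ [b _ <-]; apply: hx; exists (inc T 0 b). Qed.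

Lemma relA_star n x : relA T n x -> relA T n (star x).
Proof.
apply: commutant_star => _ [a _ <-]; exists (star a) => //.
by rewrite (incA_star hT).
Qed.

Lemma relB_star n x : relB T n x -> relB T n (star x).
Proof. exact: relcomm_star (incB_incl hT n) x. Qed.

Lemma relA_average n x : relB T n x -> relA T n (average x).
Proof.
move=> /commutant_rangeE hx; apply: commutantZ; apply/commutant_rangeE => a.
apply/esym; apply: (@weighted_central _ _ _ _ _ (E T 0) _ 1 _ _ id _
  (incA_incl hT n)) => [y|y|b]; last exact: hx.
- by rewrite scale1r; case: (hs y).
- by rewrite scale1r; case: (hs y).
Qed.

Lemma Etr_average n x : relB T n x -> Etr (average x) = Etr x.
Proof.
elim: n x => [|n IHn] x hx.
  have hmin : minimal_cond_exp (inc T 0) (E T 0) by case: hT.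
  rewrite /average (minimal_quasi_basis (inc_incl hT 0) hB hA hmin hs hr hx).
  rewrite scalerA -rmorphM divff ?(tau_neq0 hT) // scale1r /=.
  by rewrite (condK (inc_incl hT 0) (E_cond hT 0)).
rewrite /= -[RHS]IHn; last exact: relB_E.
congr Etr; rewrite EZ E_sum; congr (_ *: _); apply: eq_bigr => k _.
by rewrite /= EMr EMl.
Qed.

Lemma expectation_average n (G : alg T n.+1 -> alg T n.+1) x :
  tr_preserving_cond_exp G -> relB T n x -> G x = average x.
Proof.
move=> [[GA _ _ _ GM] Gtr] hx; apply/eqP; rewrite -subr_eq0; apply/eqP.
set d := _ - _; have hd : relA T n (star d).
  by apply/relA_star/commutantB; [exact: GA | exact: relA_average].
have hdx : relB T n (star d * x) by apply: commutantM => //; exact: relA_relB.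
apply: (@Etr_faithful _ _ _ hT); rewrite mulrBr.
rewrite (condB (incB_incl hT n) (Etr_cond hT n)) -(GM _ _ hd hx).1 Gtr //.
apply/eqP; rewrite subr_eq0 -(Etr_average hdx); apply/eqP; congr Etr.
rewrite /average -scalerAr mulr_sumr; congr (_ *: _); apply: eq_bigr => k _.
by rewrite !mulrA; congr (_ * _ * _); apply/esym/hd; exists k.
Qed.

Section Fourier.
Variable G : forall n, alg T n.+1 -> alg T n.+1.
Hypothesis hG : forall n, tr_preserving_cond_exp (@G n).

Let fcoef n : R := tau `^ (- (n.+2%:R / 2)).

Lemma fcoef_sqr n : fcoef n * fcoef n = tau^-1 ^+ n.+2.
Proof.
rewrite /fcoef -powRD; last by rewrite (tau_neq0 hT) implybT.
rewrite -opprD -splitr powRN powR_mulrn ?exprVn // ltW //.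
exact: tau_gt0 hT.
Qed.

Lemma v_relB n : relB T n (v T n).
Proof. by apply/commutant_rangeE => b; rewrite (v_comm hT). Qed.

Lemma incA1 n : iA n 1 = 1.
Proof. exact: incl1 (incA_incl hT n). Qed.

Lemma fourierE n x : relB T n x -> fourier tau G x =
  (fcoef n * tau)%:C *: \sum_(k <- s) iA n.+1 k * Qop (star k) x.
Proof.
move=> hx; rewrite /fourier (expectation_average (hG n.+1)); last first.
  by apply: commutantM; [exact: relB_inc | exact: v_relB].
rewrite /average scalerA -rmorphM; congr (_ *: _); apply: eq_bigr => k _.
by rewrite /Qop !mulrA.
Qed.

Lemma relA_fourier n x : relB T n x -> relA T n.+1 (fourier tau G x).
Proof.
move=> hx; apply: commutantZ; have [[GA _ _ _ _] _] := hG n.+1; apply: GA.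
by apply: commutantM; [exact: relB_inc | exact: v_relB].
Qed.

Definition fourier_left n (w : alg T n.+2) : alg T n.+1 :=
  (fcoef n * tau ^+ n.+1)%:C *: Rop tau 1 w.

Lemma fcoefK n : (fcoef n * tau ^+ n.+1)%:C * (fcoef n * tau)%:C = 1 :> R[i].
Proof.
rewrite -rmorphM mulrACA -exprSr fcoef_sqr -exprMn mulVf ?(tau_neq0 hT) //.
by rewrite expr1n rmorph1.
Qed.

Lemma Rop_iA n a b w :
  Rop tau b (iA n.+1 a * w) = iA n a * @Rop R T tau n.+1 b w.
Proof. by rewrite /Rop -!mulrA EMl -scalerAr. Qed.

Lemma Rop_mulr n a w : @Rop R T tau n 1 (w * iA n a) = Rop tau a w.
Proof. by rewrite /Rop incA1 mulr1. Qed.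

Lemma Rop_sum n a I (r : seq I) (F : I -> alg T n.+1) :
  Rop tau a (\sum_(k <- r) F k) = \sum_(k <- r) Rop tau a (F k).
Proof. exact: (big_morph (@Rop R T tau n a) (RopD hT a) (Rop0 hT n a)). Qed.

Lemma RopZ n a (c : R[i]) (x : alg T n.+1) :
  Rop tau a (c *: x) = c *: Rop tau a x.
Proof. by rewrite /Rop -!scalerAl EZ !scalerA mulrC. Qed.

Lemma fourier_leftK n x : relB T n x -> fourier_left (fourier tau G x) = x.
Proof.
move=> hx; rewrite fourierE // /fourier_left RopZ scalerA fcoefK scale1r Rop_sum.
transitivity (iA n (\sum_(k <- s) k * inc T 0 (E T 0 (star k * 1))) * x).
  rewrite (incl_sum (incA_incl hT n)) mulr_suml; apply: eq_bigr => k _.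
  have -> : Rop tau 1 (iA n.+1 k * Qop (star k) x) =
      iA n k * (x * iBA n (E T 0 (star k * 1))).
    by rewrite Rop_iA (Rop_Qop hT) incBE.
  by rewrite (incAM hT) -mulrA; congr (_ * _); apply: hx; eexists.
by have [<- _] := hs 1; rewrite incA1 mul1r.
Qed.

Lemma relB_fourier_left n w : relA T n.+1 w -> relB T n (fourier_left w).
Proof.
move=> hw; apply: commutantZ; apply: commutantZ; rewrite incA1 mulr1.
apply: relB_E; apply: commutantM; first exact: relA_relB.
exact/relB_star/v_relB.
Qed.

Lemma fourier_fourier_left n w : relA T n.+1 w ->
  fourier tau G (fourier_left w) = w.
Proof.
move=> hw; rewrite fourierE; last exact: relB_fourier_left.
rewrite -[RHS](sum_Qop_Rop hT hs) /fourier_left.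
rewrite scaler_sumr; apply: eq_bigr => k _.
have QZ (c : R[i]) u : Qop (star k) (c *: u) = c *: @Qop R T n.+1 (star k) u.
  by rewrite /Qop incZ -!scalerAl.
rewrite QZ -scalerAr scalerA mulrC fcoefK scale1r.
have -> : iA n.+1 k * Qop (star k) (Rop tau 1 w) =
    Qop (star k) (iA n k * Rop tau 1 w) by rewrite /Qop incM !mulrA.
congr Qop; rewrite -Rop_iA -(Rop_mulr k w); congr Rop.
by apply/esym/hw; exists k.
Qed.

Lemma fourier_invE n w : relA T n.+1 w ->
  fourier_inv tau G w = fourier_left w.
Proof.
move=> hw; have hx := relB_fourier_left hw.
rewrite /fourier_inv -{1}(fourier_fourier_left hw) pinvKV ?inE //.
by move=> x y /[!inE] hx' hy' /(congr1 (@fourier_left n)); rewrite !fourier_leftK.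
Qed.

Lemma rotation_fourier n x : relB T n x ->
  relB T n (@tensor_shift R T tau s n x) /\
  rotation tau G (fourier tau G x) = fourier tau G (tensor_shift tau s x).
Proof.
move=> hx; have hw := relA_fourier hx.
have hrot : relA T n.+1 (rotation tau G (fourier tau G x)).
  apply: relA_star; apply: relA_fourier; apply: relB_star.
  by rewrite fourier_invE //; apply: relB_fourier_left.
have shiftE : fourier_left (rotation tau G (fourier tau G x)) = tensor_shift tau s x.
  rewrite /rotation fourier_invE // fourier_leftK // fourierE; last first.
    exact: relB_star.
  rewrite starZr /fourier_left RopZ scalerA fcoefK scale1r raddf_sum /= Rop_sum.
  apply: eq_bigr => k _; rewrite starM (star_Qop hT) !starK -(incA_star hT).
  by rewrite Rop_mulr (Rop_Lop hT).
split; first by rewrite -shiftE; apply: relB_fourier_left.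
by rewrite -shiftE fourier_fourier_left.
Qed.

Lemma iter_rotation n (w : alg T n.+2) : relA T n.+1 w ->
  iter n.+1 (rotation tau G) w = w.
Proof.
move=> hw; have hx := relB_fourier_left hw.
rewrite -(fourier_fourier_left hw) -[in RHS](iter_tensor_shift_id hx).
suff h j : relB T n (iter j (@tensor_shift R T tau s n) (fourier_left w)) /\
    iter j (rotation tau G) (fourier tau G (fourier_left w)) =
    fourier tau G (iter j (@tensor_shift R T tau s n) (fourier_left w)).
  by case: (h n.+1).
elim: j => // j [hj /= ->].
exact: rotation_fourier.
Qed.

End Fourier.

End Rotation.

Theorem theorem3p10 (R : realType) (T : tower R) (tau : R)
    (hB : simple_cstar (alg T 0)) (hA : simple_cstar (alg T 1))
    (hT : is_jones_tower T tau)
    (G : forall n : nat, alg T n.+1 -> alg T n.+1)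
    (hG : forall n : nat, tr_preserving_cond_exp (G n))
    (n : nat) (hn : (1 <= n)%N)
    (w : alg T n.+2) (hw : relA T n.+1 w) :
  iter n.+1 (rotation tau G) w = w.
Proof.
have [s hs hr] := finite_index hT.
exact: iter_rotation hT hB hA s hs hr G hG n w hw.
Qed.
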